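(* Let $p:\mathbb{N}\to[0,1]$ satisfy one of the following: (a) (Density) $p(n)\to \tilde p$ for some $\tilde p>0$; (b) (Root growth) $p(n)=Kn^{-\beta}$ for some $K>0$ and $0<\beta<1$; (c) (Logarithmic growth) $p(n)=K\frac{\log n}{n}$ for some $K>0$. Let $\mu_n$ be the distribution that samples a graph $G\sim \mathrm{ER}(n,p(n))$ and independently assigns to each node an i.i.d. feature vector drawn from a fixed bounded distribution on $\mathbb{R}^d$. Then every closed term of the language $\mathrm{Agg}[\mathrm{WMean},\mathrm{RW}]$ converges asymptotically almost surely with respect to $(\mu_n)_{n\in\mathbb{N}}$.
   Context: Graphs are finite simple undirected graphs; $N(v)$ denotes the set of neighbours of a node $v$ and $d(v)=|N(v)|$. $\mathrm{ER}(n,p)$ is the Erdős–Rényi graph on $n$ nodes, each edge present independently with probability $p$. Each node $v$ carries a feature vector $H_G(v)$. Fix $k_0\in\mathbb{N}$; for a node $v$, $\mathrm{rw}(v)\in\mathbb{R}^{k_0}$ is the vector whose $j$-th entry is the probability that a simple random walk of $j$ steps started at $v$ is at $v$ after $j$ steps ($\mathrm{rw}(v)=0$ if $v$ is isolated). Terms of $\mathrm{Agg}[\mathrm{WMean},\mathrm{RW}]$ with free node variables $x_1,\dots,x_k$ are built as follows; a term $\tau(x_1,\dots,x_k)$ is interpreted in a graph $G$ at a $k$-tuple of nodes $\bar u$ as a vector $[\![\tau(\bar u)]\!]_G\in\mathbb{R}^e$ (for some dimension $e$ depending on the term): (i) $H(x_i)$, interpreted as $H_G(u_i)$; (ii) any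 constant vector $c$; (iii) $\mathrm{rw}(x_i)$, interpreted as $\mathrm{rw}(u_i)$; (iv) $f(\rho_1,\dots,\rho_r)$ for terms $\rho_j$ and a Lipschitz function $f$, interpreted as $f([\![\rho_1(\bar u)]\!],\dots,[\![\rho_r(\bar u)]\!])$; (v) global weighted mean $\sum_y \rho(\bar x,y)\star h(\eta(\bar x,y))$, where $\rho,\eta$ are terms, $\rho$ takes values in $\mathbb{R}^e$, and $h$ is a function with values in $(0,\infty)^e$ which is Lipschitz on bounded sets; interpreted as $\big(\sum_{v\in V(G)}[\![\rho(\bar u,v)]\!]\odot h([\![\eta(\bar u,v)]\!])\big)\oslash\big(\sum_{v\in V(G)}h([\![\eta(\bar u,v)]\!])\big)$, with $\odot,\oslash$ componentwise product and division; (vi) local weighted mean $\sum_{y\in N(x_i)}\rho(\bar x,y)\star h(\eta(\bar x,y))$, interpreted as in (v) but with both sums over $v\in N(u_i)$, and as $0$ if $N(u_i)=\emptyset$. A closed term $\tau$ (no free variables) has a value $[\![\tau]\!]_G$ depending only on the featured graph $G$. It converges asymptotically almost surely (a.a.s.) with respect to $(\mu_n)$ if there is a constant vector $z$ such that for all $\epsilon,\theta>0$ there is $N$ with $\Pr_{G\sim\mu_n}(\|[\![\tau]\!]_G-z\|<\epsilon)\ge 1-\theta$ for all $n\ge N$. *)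

(* Defs.v *)
From HB Require Import structures.
From mathcomp Require Import all_boot all_order all_algebra.
From mathcomp Require Import all_classical all_reals all_analysis.
Set Implicit Arguments. Unset Strict Implicit. Unset Printing Implicit Defensive.
Import Order.TTheory GRing.Theory Num.Theory.
Import numFieldTopology.Exports numFieldNormedType.Exports.
Local Open Scope ring_scope.

Notation borelRV R d := (g_sigma_algebraType (@open 'rV[R]_d)).

Section Defs.
Variable R : realType.

Definition vnorm (e : nat) (v : 'rV[R]_e) : R := \big[Num.max/0]_(i < e) `|v ord0 i|.


Definition lipschitzN (r : nat) (es : 'I_r -> nat) (e : nat)
  (f : (forall j : 'I_r, 'rV[R]_(es j)) -> 'rV[R]_e) : Prop :=
  exists L : R, forall x y : (forall j : 'I_r, 'rV[R]_(es j)),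
    vnorm (f x - f y) <= L * \big[Num.max/0]_(j < r) vnorm (x j - y j).

Definition lipschitz_bdd (e1 e2 : nat) (h : 'rV[R]_e1 -> 'rV[R]_e2) : Prop :=
  forall B : R, exists L : R, forall x y : 'rV[R]_e1,
    vnorm x <= B -> vnorm y <= B -> vnorm (h x - h y) <= L * vnorm (x - y).

Definition pos_valued (e1 e2 : nat) (h : 'rV[R]_e1 -> 'rV[R]_e2) : Prop :=
  forall x i, 0 < h x ord0 i.

(* Terms of Agg[WMean,RW]: [term k e] has free node variables x_0..x_{k-1}
   (indexed by 'I_k) and values in R^e.  [d] is the feature dimension and
   [k0] the length of the random-walk vectors. *)
Inductive term (d k0 : nat) : nat -> nat -> Type :=
| TFeat k (i : 'I_k) : term d k0 k d
| TConst k e (c : 'rV[R]_e) : term d k0 k e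
| TRw k (i : 'I_k) : term d k0 k k0
| TApp k (r : nat) (es : 'I_r -> nat) (args : forall j : 'I_r, term d k0 k (es j))
    e (f : (forall j : 'I_r, 'rV[R]_(es j)) -> 'rV[R]_e) :
    lipschitzN f -> term d k0 k e
| TGMean k e (rho : term d k0 k.+1 e) e' (eta : term d k0 k.+1 e')
    (h : 'rV[R]_e' -> 'rV[R]_e) :
    pos_valued h -> lipschitz_bdd h -> term d k0 k e
| TLMean k (i : 'I_k) e (rho : term d k0 k.+1 e) e' (eta : term d k0 k.+1 e')
    (h : 'rV[R]_e' -> 'rV[R]_e) :
    pos_valued h -> lipschitz_bdd h -> term d k0 k e.

Definition adj (n : nat) := {ffun 'I_n * 'I_n -> bool}.

Definition simple_graph n (A : adj n) : bool :=
  [forall u, ~~ A (u, u)] && [forall u, forall v, A (u, v) == A (v, u)].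

Definition nbhd n (A : adj n) (u : 'I_n) : {set 'I_n} := [set v | A (u, v)].
Definition deg n (A : adj n) (u : 'I_n) : nat := #|nbhd A u|.

Definition nedges n (A : adj n) : nat :=
  #|[set x : 'I_n * 'I_n | A x & (val x.1 < val x.2)%N]|.

Definition ER_prob n (q : R) (A : adj n) : R :=
  if simple_graph A then q ^+ nedges A * (1 - q) ^+ ('C(n, 2) - nedges A)
  else 0.

Definition rw_step n (A : adj n) (q : 'I_n -> R) : 'I_n -> R :=
  fun w => \sum_(u : 'I_n) q u * (if A (u, w) then (deg A u)%:R^-1 else 0).

Definition return_prob n (A : adj n) (v : 'I_n) (j : nat) : R :=
  if (deg A v == 0)%N then 0
  else iter j (rw_step A) (fun w => (w == v)%:R) v.

Definition rw_vec n (A : adj n) (k0 : nat) (v : 'I_n) : 'rV[R]_k0 :=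
  \row_(i < k0) return_prob A v i.+1.

Definition ext (T : Type) (k : nat) (u : 'I_k -> T) (v : T) : 'I_k.+1 -> T :=
  fun j => if unlift ord_max j is Some j' then u j' else v.

Definition cmul e (a b : 'rV[R]_e) : 'rV[R]_e := \row_i (a ord0 i * b ord0 i).
Definition cdiv e (a b : 'rV[R]_e) : 'rV[R]_e := \row_i (a ord0 i / b ord0 i).

Fixpoint eval (d k0 : nat) (n : nat) (A : adj n) (X : 'I_n -> 'rV[R]_d)
  (k e : nat) (t : term d k0 k e) (u : 'I_k -> 'I_n) {struct t} : 'rV[R]_e :=
  match t in term _ _ k e return ('I_k -> 'I_n) -> 'rV[R]_e with
  | TFeat _ i => fun u => X (u i)
  | TConst _ _ c => fun _ => c
  | TRw _ i => fun u => rw_vec A k0 (u i)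
  | TApp _ _ _ args _ f _ => fun u => f (fun j => eval A X (args j) u)
  | TGMean _ _ rho _ eta h _ _ => fun u =>
      cdiv (\sum_(v : 'I_n) cmul (eval A X rho (ext u v)) (h (eval A X eta (ext u v))))
           (\sum_(v : 'I_n) h (eval A X eta (ext u v)))
  | TLMean _ i _ rho _ eta h _ _ => fun u =>
      if (deg A (u i) == 0)%N then 0 else
      cdiv (\sum_(v in nbhd A (u i)) cmul (eval A X rho (ext u v)) (h (eval A X eta (ext u v))))
           (\sum_(v in nbhd A (u i)) h (eval A X eta (ext u v)))
  end u.

Definition no_nodes (n : nat) : 'I_0 -> 'I_n.
Proof. by case=> m; rewrite ltn0. Defined.

Definition eval_closed d k0 n (A : adj n) (X : 'I_n -> 'rV[R]_d) e
  (t : term d k0 0 e) : 'rV[R]_e :=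
  eval A X t (no_nodes n).

End Defs.

Section Model.
Variable R : realType.
Local Open Scope classical_set_scope.

(* [G n] and [X n] realize mu_n on the probability space (Omega, P):
   the featured graph (G n w, X n w) has law mu_n, i.e. the graph is
   ER(n, p n), the features X n w i (i : 'I_n) are i.i.d. with law nu,
   and the features are independent of the graph.  The law is pinned down
   by its values on all "rectangles" {graph = A} x B_0 x ... x B_{n-1}. *)
Definition featured_ER_model (dO : measure_display) (Omega : measurableType dO)
  (P : probability Omega R) (d : nat) (nu : probability (borelRV R d) R)
  (p : nat -> R) (G : forall n, Omega -> adj n)
  (X : forall n, Omega -> 'I_n -> borelRV R d) : Prop :=
  [/\ (forall n (i : 'I_n), measurable_fun setT (fun w => X n w i)),
      (forall n (A : adj n), measurable [set w | G n w = A]) &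
      (forall n (A : adj n) (B : 'I_n -> set (borelRV R d)),
         (forall i, measurable (B i)) ->
         P [set w | G n w = A /\ forall i, B i (X n w i)]
           = ((ER_prob (p n) A)%:E * \prod_(i < n) nu (B i))%E)].

Definition bounded_distribution d (nu : probability (borelRV R d) R) : Prop :=
  exists M : R, nu [set x | vnorm (x : 'rV[R]_d) <= M] = 1%E.

Definition edge_prob_regime (p : nat -> R) : Prop :=
  (forall n, 0 <= p n <= 1) /\
  [\/
       exists pt : R, 0 < pt /\ p @ \oo --> pt,
       exists K beta : R, [/\ 0 < K, 0 < beta < 1 &
          \forall n \near \oo, p n = K * (n%:R `^ (- beta))]
     |
       exists K : R, 0 < K /\
          \forall n \near \oo, p n = K * (ln n%:R / n%:R)].

End Model.

(* Main.v *)
Require Import Defs.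
From HB Require Import structures.
From mathcomp Require Import all_boot all_order all_algebra.
From mathcomp Require Import all_classical all_reals all_analysis.
From mathcomp Require Import ring lra.
Import Order.TTheory GRing.Theory Num.Theory.
Import numFieldTopology.Exports numFieldNormedType.Exports.
Set Implicit Arguments. Unset Strict Implicit. Unset Printing Implicit Defensive.
Local Open Scope ring_scope.

(** All three regimes give n p(n) -> oo, and nothing else about p is used.

Replace the features by a finite alphabet S with weights w: terms are Lipschitz
in the features, uniformly in the graph.  By induction on a term t there is a
function phi of the letters of its variables such that t is close to phi on
average, where each variable is drawn either uniformly from all nodes or
uniformly from the neighbourhood of an earlier variable; both kinds of weighted
mean become the w-weighted mean over one more letter.  So adjacency between the
variables is irrelevant in the limit, and rw(x) tends to 0.

The induction needs that such a variable rarely has small degree.  The degree is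
an invariant measure of the random walk, so, up to the fraction of nodes of
degree less than a, the mean of 1/max(1,deg) at a variable is at most 1/a.  In
ER(n,p) this fraction is at most 2^a E[2^-deg] = 2^a (1 - p/2)^(n-1) in mean.
The law of large numbers over a neighbourhood is a second-moment bound.  Finally
the limits obtained for finer and finer alphabets form a Cauchy sequence. *)

(** * The norm and the weights *)

Section SupNorm.
Context {R : realType}.

Lemma vnorm_ge0 e (v : 'rV[R]_e) : 0 <= vnorm v.
Proof. exact: bigmax_ge_id. Qed.

Lemma coord_le_vnorm e (v : 'rV[R]_e) i : `|v ord0 i| <= vnorm v.
Proof. exact: (le_bigmax 0 (fun i => `|v ord0 i|)). Qed.

Lemma vnorm_le e (v : 'rV[R]_e) C :
  0 <= C -> (forall i, `|v ord0 i| <= C) -> vnorm v <= C.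
Proof. by move=> C0 vC; apply: bigmax_le. Qed.

Lemma vnormD e (u v : 'rV[R]_e) : vnorm (u + v) <= vnorm u + vnorm v.
Proof.
apply: vnorm_le => [|i]; first by rewrite addr_ge0 ?vnorm_ge0.
by rewrite mxE (le_trans (ler_normD _ _))// lerD ?coord_le_vnorm.
Qed.

Lemma vnormN e (v : 'rV[R]_e) : vnorm (- v) = vnorm v.
Proof. by apply: eq_bigr => i _; rewrite mxE normrN. Qed.

Lemma vnorm_distC e (u v : 'rV[R]_e) : vnorm (u - v) = vnorm (v - u).
Proof. by rewrite -vnormN opprB. Qed.

Lemma vnorm_dist_triangle e (w u v : 'rV[R]_e) :
  vnorm (u - v) <= vnorm (u - w) + vnorm (w - v).
Proof. by rewrite -{1}(subrKA w u (- v)) -[_ + (w - v)]/(_) vnormD. Qed.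

Lemma vnorm0 e : vnorm (0 : 'rV[R]_e) = 0.
Proof.
by apply/le_anti; rewrite vnorm_ge0 andbT vnorm_le// => i; rewrite mxE normr0.
Qed.

Lemma vnorm_le_sum e (v : 'rV[R]_e) : vnorm v <= \sum_i `|v ord0 i|.
Proof.
apply: vnorm_le => [|i]; first exact: sumr_ge0.
by rewrite (bigD1 i)//= lerDl sumr_ge0.
Qed.

(** Sums, unlike maxima, commute with the averages taken later. The absolute value is there because
    the given constant may be negative. *)
Lemma lipschitzN_sum r (es : 'I_r -> nat) e
    (f : (forall j : 'I_r, 'rV[R]_(es j)) -> 'rV[R]_e) : lipschitzN f ->
  exists2 L, 0 <= L &
    forall x y, vnorm (f x - f y) <= L * \sum_j vnorm (x j - y j).
Proof.
move=> [L fL]; exists `|L| => // x y; apply: le_trans (fL x y) _.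
apply: le_trans (ler_wpM2r _ (ler_norm L)) _; first exact: bigmax_ge_id.
apply: ler_wpM2l => //; apply: bigmax_le => [|i _].
  by apply: sumr_ge0 => j _; exact: vnorm_ge0.
by rewrite (bigD1 i)//= lerDl sumr_ge0// => j _; exact: vnorm_ge0.
Qed.

Lemma compact_vnorm_ball e (B : R) :
  compact [set x : 'rV[R]_e | vnorm x <= B]%classic.
Proof.
have [B0|B0] := leP 0 B.
  have -> : [set x : 'rV[R]_e | vnorm x <= B]%classic =
      [set x : 'rV[R]_e | forall i, `[- B, B]%classic (x ord0 i)]%classic.
    apply/seteqP; split => x /= xB.
      move=> i; rewrite /= in_itv/= -ler_norml.
      exact: le_trans (coord_le_vnorm x i) xB.
    apply: vnorm_le => // i; rewrite ler_norml.
    by have := xB i; rewrite /= in_itv.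
  apply: (@rV_compact R _ (fun=> `[- B, B]%classic)) => i.
  exact: segment_compact.
have -> : [set x : 'rV[R]_e | vnorm x <= B]%classic = classical_sets.set0.
  apply/seteqP; split => // x /= /(le_trans (vnorm_ge0 x)).
  by rewrite leNgt B0.
exact: compact0.
Qed.

(** On a compact ball the continuous coordinates of [h] attain a positive minimum. This [m] keeps
    the denominators of weighted means away from 0. *)
Lemma pos_lipschitz_bounds e1 e2 (h : 'rV[R]_e1 -> 'rV[R]_e2) (B : R) :
  pos_valued h -> lipschitz_bdd h ->
  exists m H L : R, [/\ 0 < m, 0 <= H, 0 <= L,
   (forall x i, vnorm x <= B -> m <= h x ord0 i <= H) &
   (forall x y i, vnorm x <= B -> vnorm y <= B ->
      `|h x ord0 i - h y ord0 i| <= L * vnorm (x - y))].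
Proof.
move=> hp hl; have [L hL] := hl B.
have hL' x y i : vnorm x <= B -> vnorm y <= B ->
    `|h x ord0 i - h y ord0 i| <= `|L| * vnorm (x - y).
  move=> xB yB; have := coord_le_vnorm (h x - h y) i.
  rewrite !mxE => /le_trans; apply; apply: le_trans (hL _ _ xB yB) _.
  by rewrite ler_wpM2r ?vnorm_ge0// ler_norm.
have [B0|B0] := leP 0 B; last first.
  exists 1, 0, 0; split=> // x => [i xB|y i xB].
    by move: (le_trans (vnorm_ge0 x) xB); rewrite leNgt B0.
  by move: (le_trans (vnorm_ge0 x) xB); rewrite leNgt B0.
pose K := [set x : 'rV[R]_e1 | vnorm x <= B]%classic.
have lower i : exists c, 0 < c /\ forall x, vnorm x <= B -> c <= h x ord0 i.
  have [|||c cK cmin] := @EVT_min_rV R e1 (fun x => h x ord0 i) K.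
  - by exists 0; rewrite /K/= vnorm0.
  - exact: compact_vnorm_ball.
  - apply/subspace_continuousP => x xB; apply/cvgrPdist_lt => eps eps0.
    have L1 : 0 < `|L| + 1 by rewrite ltr_wpDl.
    have d0 : 0 < eps / (`|L| + 1) by rewrite divr_gt0.
    rewrite /within/=; apply/nbhs_ballP; exists (eps / (`|L| + 1)) => //=.
    move=> y xy yB; apply: le_lt_trans (hL' x y i xB yB) _.
    have xy' : vnorm (x - y) <= eps / (`|L| + 1).
      apply: vnorm_le => [|j]; first exact: ltW.
      by rewrite !mxE; apply/ltW; case: xy => _; exact.
    apply: (@le_lt_trans _ _ (`|L| * (eps / (`|L| + 1)))).
      by rewrite ler_wpM2l.
    by rewrite mulrA ltr_pdivrMr// mulrDr mulr1 mulrC ltrDl.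
  exists (h c ord0 i); split; first exact: hp.
  by move=> x xB; apply: cmin; rewrite inE.
have [c cP] := choice lower.
(* The default 1 keeps the minimum positive when there are no coordinates; the upper bound comes
   from comparison with [h 0]. *)
exists (\big[Num.min/1]_i c i), (vnorm (h 0) + `|L| * B), `|L|; split=> //.
- by apply: lt_bigmin => // i _; exact: (cP i).1.
- by rewrite addr_ge0 ?vnorm_ge0// mulr_ge0.
move=> x i xB; apply/andP; split.
  by apply: le_trans ((cP i).2 x xB); exact: bigmin_le.
have h0 : vnorm (0 : 'rV[R]_e1) <= B by rewrite vnorm0.
have := hL' x 0 i xB h0; rewrite subr0 => hx.
rewrite -(subrK (h 0 ord0 i) (h x ord0 i)) addrC lerD//.
  exact: le_trans (ler_norm _) (coord_le_vnorm _ i).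
apply: le_trans (ler_norm _) (le_trans hx _).
by rewrite ler_wpM2l.
Qed.

End SupNorm.

(** * Averages, weighted means and walks *)

Section Averages.
Context {R : realType} {I : finType}.
Implicit Types (V : {set I}) (f g r h : I -> R).

(** Since [0^-1 = 0], the average over the empty set is 0, and so is [wmean] below. This is the
    value of a local mean at an isolated node. *)
Definition avg V f : R := #|V|%:R^-1 * \sum_(v in V) f v.

Lemma avg_le V f g : (forall v, v \in V -> f v <= g v) -> avg V f <= avg V g.
Proof. by move=> fg; rewrite ler_wpM2l ?invr_ge0// ler_sum. Qed.

Lemma avg_ge0 V f : (forall v, v \in V -> 0 <= f v) -> 0 <= avg V f.
Proof. by move=> f0; rewrite mulr_ge0 ?invr_ge0// sumr_ge0. Qed.

Lemma avgD V f g : avg V (fun v => f v + g v) = avg V f + avg V g.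
Proof. by rewrite /avg big_split mulrDr. Qed.

Lemma avgB V f g : avg V (fun v => f v - g v) = avg V f - avg V g.
Proof. by rewrite /avg sumrB mulrBr. Qed.

Lemma avgZ V c f : avg V (fun v => c * f v) = c * avg V f.
Proof. by rewrite /avg -mulr_sumr mulrCA. Qed.

Lemma avg_sum V (J : finType) (F : J -> I -> R) :
  avg V (fun v => \sum_j F j v) = \sum_j avg V (F j).
Proof. by rewrite /avg exchange_big mulr_sumr. Qed.

Lemma avg_cst V c : V != finset.set0 -> avg V (fun=> c) = c.
Proof.
move=> V0; rewrite /avg sumr_const -[c *+ _]mulr_natl mulKf//.
by rewrite pnatr_eq0 -lt0n card_gt0.
Qed.

Lemma avg_cst_le V c : 0 <= c -> avg V (fun=> c) <= c.
Proof.
move=> c0; have [->|/avg_cst->//] := eqVneq V finset.set0.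
by rewrite /avg big_set0 mulr0.
Qed.

Lemma ler_norm_avg V f : `|avg V f| <= avg V (fun v => `|f v|).
Proof.
by rewrite /avg normrM ger0_norm ?invr_ge0// ler_wpM2l ?invr_ge0// ler_norm_sum.
Qed.

Definition wmean V r h : R := (\sum_(v in V) r v * h v) / (\sum_(v in V) h v).

Lemma wmean_avg V r h : V != finset.set0 ->
  wmean V r h = avg V (fun v => r v * h v) / avg V h.
Proof.
move=> V0; rewrite /wmean /avg invfM mulrACA mulfV ?mul1r//.
by rewrite invr_neq0// pnatr_eq0 -lt0n card_gt0.
Qed.

Lemma ler_norm_wmean V r h C : 0 <= C -> (forall v, v \in V -> 0 < h v) ->
  (forall v, v \in V -> `|r v| <= C) -> `|wmean V r h| <= C.
Proof.
move=> C0 h0 rC; have H0 : 0 <= \sum_(v in V) h v.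
  by apply: sumr_ge0 => v /h0/ltW.
rewrite /wmean normrM normfV (ger0_norm H0).
have [->|Hn] := eqVneq (\sum_(v in V) h v) 0; first by rewrite invr0 mulr0.
rewrite ler_pdivrMr ?lt_def ?Hn// mulr_sumr.
apply: le_trans (ler_norm_sum _ _ _) _; apply: ler_sum => v vV.
by rewrite normrM (gtr0_norm (h0 v vV)) ler_wpM2r ?rC// ltW ?h0.
Qed.

(** With [q = N' / D'] the difference is [((N - N') - q (D - D')) / D]. So only [D] has to stay away
    from 0; of the second quotient a bound is enough. *)
Lemma ratio_dist (m C N D N' D' : R) : 0 < m -> m <= D -> D' != 0 ->
  `|N' / D'| <= C -> `|N / D - N' / D'| <= m^-1 * (`|N - N'| + C * `|D - D'|).
Proof.
move=> m0 mD D'0 qC; have D0 : 0 < D by exact: lt_le_trans mD.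
have -> : N / D - N' / D' = ((N - N') - N' / D' * (D - D')) / D.
  by field; rewrite D'0 gt_eqF.
rewrite normrM normfV (gtr0_norm D0) mulrC.
apply: ler_pM; rewrite ?invr_ge0 ?lef_pV2 ?posrE// ?(ltW D0)//.
apply: le_trans (ler_normB _ _) _; rewrite lerD2l normrM.
by rewrite ler_wpM2r.
Qed.

Lemma wmean_dist V r h m C N' D' : V != finset.set0 -> 0 < m ->
  (forall v, v \in V -> m <= h v) -> D' != 0 -> `|N' / D'| <= C ->
  `|wmean V r h - N' / D'| <=
    m^-1 * (`|avg V (fun v => r v * h v) - N'| + C * `|avg V h - D'|).
Proof.
move=> V0 m0 mh D'0 qC; rewrite wmean_avg//; apply: ratio_dist => //.
by rewrite -(avg_cst m V0) avg_le.
Qed.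

Lemma mul_dist (r h r' h' C H : R) : `|r'| <= C -> `|h| <= H ->
  `|r * h - r' * h'| <= H * `|r - r'| + C * `|h - h'|.
Proof.
move=> rC hH; have -> : r * h - r' * h' = h * (r - r') + r' * (h - h') by ring.
by apply: le_trans (ler_normD _ _) _; rewrite !normrM lerD// ler_wpM2r.
Qed.

(** Serves for perturbed features, where the errors are controlled at every node. *)
Lemma wmean_lipschitz V r h r' h' m C H a b : V != finset.set0 -> 0 < m ->
  (forall v, v \in V -> m <= h v <= H) -> (forall v, v \in V -> 0 < h' v) ->
  (forall v, v \in V -> `|r' v| <= C) ->
  (forall v, v \in V -> `|r v - r' v| <= a) ->
  (forall v, v \in V -> `|h v - h' v| <= b) ->
  `|wmean V r h - wmean V r' h'| <= m^-1 * (H * a + C * b + C * b).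
Proof.
move=> V0 m0 mhH h'0 rC ra hb.
have [v0 v0V] : exists v, v \in V by apply/set0Pn.
have C0 : 0 <= C by rewrite (le_trans _ (rC _ v0V)).
have H0 : 0 <= H by have /andP[/(lt_le_trans m0)/ltW/le_trans] := mhH _ v0V; apply.
have a0 : 0 <= a by rewrite (le_trans _ (ra _ v0V)).
have b0 : 0 <= b by rewrite (le_trans _ (hb _ v0V)).
have D'0 : 0 < avg V h'.
  rewrite mulr_gt0 ?invr_gt0 ?ltr0n ?card_gt0//.
  rewrite (bigD1 v0)//= ltr_wpDr ?h'0// sumr_ge0// => v /andP[vV _].
  by rewrite ltW ?h'0.
rewrite (wmean_avg r' h' V0).
apply: le_trans (@wmean_dist V r h m C _ _ V0 m0 _ _ _) _.
- by move=> v /mhH/andP[].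
- by rewrite gt_eqF.
- by rewrite -wmean_avg// ler_norm_wmean.
rewrite ler_wpM2l ?invr_ge0 ?(ltW m0)// lerD//.
  rewrite -avgB; apply: le_trans (ler_norm_avg _ _) _.
  rewrite -(avg_cst (H * a + C * b) V0); apply: avg_le => v vV.
  apply: le_trans (@mul_dist _ _ _ _ C H _ _) _; first exact: rC.
    have /andP[mv hH] := mhH v vV.
    by rewrite ger0_norm// (le_trans (ltW m0)).
  by rewrite lerD// ler_wpM2l ?ra ?hb.
rewrite ler_wpM2l// -avgB; apply: le_trans (ler_norm_avg _ _) _.
by rewrite -(avg_cst b V0); apply: avg_le => v vV; exact: hb.
Qed.

(** Serves for convergence to a limit ratio: [er] and [ee] enter only through their averages, and
    the last two terms are left to the law of large numbers. *)
Lemma wmean_error V r h r' h' er ee m H C L N' D' : V != finset.set0 ->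
  0 < m -> 0 <= C -> (forall v, m <= h v <= H) -> (forall v, `|r' v| <= C) ->
  (forall v, `|r v - r' v| <= er v) -> (forall v, `|h v - h' v| <= L * ee v) ->
  D' != 0 -> `|N' / D'| <= C ->
  `|wmean V r h - N' / D'| <= m^-1 * (H * avg V er + (C * L + C * L) * avg V ee +
     `|avg V (fun v => r' v * h' v) - N'| + C * `|avg V h' - D'|).
Proof.
move=> V0 m0 C0 mhH rC rer hee D'0 qC.
apply: le_trans (@wmean_dist V r h m C N' D' V0 m0 _ D'0 qC) _ => [v _|].
  by have /andP[] := mhH v.
rewrite ler_wpM2l ?invr_ge0 ?(ltW m0)//.
have num : `|avg V (fun v => r v * h v) - N'| <=
    H * avg V er + C * L * avg V ee + `|avg V (fun v => r' v * h' v) - N'|.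
  apply: le_trans (ler_distD (avg V (fun v => r' v * h' v)) _ _) _.
  rewrite lerD2r -avgB -!avgZ -avgD; apply: le_trans (ler_norm_avg _ _) _.
  apply: avg_le => v _; have /andP[mh hH] := mhH v.
  apply: le_trans (@mul_dist _ _ _ _ C H _ _) _ => //.
    by rewrite ger0_norm// (le_trans (ltW m0)).
  rewrite -mulrA lerD// ler_wpM2l//.
  by rewrite (le_trans (ltW m0))// (le_trans mh).
have den : `|avg V h - D'| <= L * avg V ee + `|avg V h' - D'|.
  apply: le_trans (ler_distD (avg V h') _ _) _.
  rewrite lerD2r -avgB -avgZ; apply: le_trans (ler_norm_avg _ _) _.
  by apply: avg_le => v _; exact: hee.
apply: le_trans (lerD num (ler_wpM2l C0 den)) _.
by rewrite le_eqVlt; apply/orP; left; apply/eqP; ring.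
Qed.

End Averages.

(** * Global and local means treated alike *)

Section Evaluation.
Context {R : realType} {d k0 : nat}.
Local Notation ev := (@Defs.eval R d k0).

(* [None] stands for the global mean and [Some i] for the mean over N(x_i). *)
Definition scope n (A : adj n) k (o : option 'I_k) (u : 'I_k -> 'I_n) :=
  if o is Some i then nbhd A (u i) else [set: 'I_n].

Definition tmean k (o : option 'I_k) e (rho : term R d k0 k.+1 e) e'
    (eta : term R d k0 k.+1 e') (h : 'rV[R]_e' -> 'rV[R]_e)
    (hp : pos_valued h) (hl : lipschitz_bdd h) : term R d k0 k e :=
  if o is Some i then TLMean i rho eta hp hl else TGMean rho eta hp hl.

(** One case for both kinds of mean, so that every induction on terms argues about weighted means
    once. *)
Lemma term_tmean_ind (P : forall k e, term R d k0 k e -> Prop) :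
  (forall k i, P k d (TFeat R d k0 i)) ->
  (forall k e c, P k e (TConst d k0 k c)) ->
  (forall k i, P k k0 (TRw R d k0 i)) ->
  (forall k r es args, (forall j : 'I_r, P k (es j) (args j)) ->
     forall e (f : (forall j : 'I_r, 'rV[R]_(es j)) -> 'rV[R]_e)
       (fl : lipschitzN f), P k e (TApp args fl)) ->
  (forall k o e rho, P k.+1 e rho -> forall e' eta, P k.+1 e' eta ->
     forall (h : 'rV[R]_e' -> 'rV[R]_e) (hp : pos_valued h)
       (hl : lipschitz_bdd h), P k e (tmean o rho eta hp hl)) ->
  forall k e t, P k e t.
Proof.
move=> Pf Pc Pr Pa Pm k e t; elim: t => {k e}.
- exact: Pf.
- exact: Pc.
- exact: Pr.
- by move=> k r es args IH e f fl; exact: Pa.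
- by move=> k e rho IHr e' eta IHe h hp hl; apply: (Pm _ None).
- by move=> k i e rho IHr e' eta IHe h hp hl; apply: (Pm _ (Some i)).
Qed.

Lemma eval_tmean n (A : adj n) X k o e (rho : term R d k0 k.+1 e) e'
    (eta : term R d k0 k.+1 e') (h : 'rV[R]_e' -> 'rV[R]_e)
    (hp : pos_valued h) (hl : lipschitz_bdd h) u i :
  ev A X (tmean o rho eta hp hl) u ord0 i =
  wmean (scope A o u) (fun v => ev A X rho (ext u v) ord0 i)
    (fun v => h (ev A X eta (ext u v)) ord0 i).
Proof.
rewrite /wmean /scope; case: o => [j|] /=.
  (* At an isolated node the prescribed value 0 agrees with [0 / 0 = 0] in [wmean]. *)
  case: ifPn => [/eqP/cards0_eq->|_]; first by rewrite !big_set0 mul0r mxE.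
  by rewrite mxE !summxE; congr (_ / _); apply: eq_bigr => v _; rewrite mxE.
rewrite mxE !summxE; congr (_ / _); last by apply: eq_bigl => v; rewrite inE.
by apply: eq_big => v; rewrite ?inE// mxE.
Qed.

End Evaluation.

(** * Random walks and neighbourhood averages *)

Section Walks.
Context {R : realType} {n : nat} (A : adj n).
Implicit Types f q : 'I_n -> R.

(** [nbavg] is the transition operator of the walk on functions, with value 0 at isolated nodes. In
    [degdec] the maximum with 1 gives isolated nodes the largest value 1 instead of [0^-1 = 0]. *)
Definition nbavg f (u : 'I_n) : R := avg (nbhd A u) f.
Definition degdec (u : 'I_n) : R := (maxn 1 (deg A u))%:R^-1.

Lemma nbavg_mono f f' : (forall u, f u <= f' u) ->
  forall u, nbavg f u <= nbavg f' u.
Proof. by move=> ff' u; exact: avg_le. Qed.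

Lemma iter_nbavg_mono f f' j : (forall u, f u <= f' u) ->
  forall u, iter j nbavg f u <= iter j nbavg f' u.
Proof. by move=> ff'; elim: j => //= j IH; exact: nbavg_mono. Qed.

Lemma iter_nbavg_ge0 f j : (forall u, 0 <= f u) -> forall u, 0 <= iter j nbavg f u.
Proof. by move=> f0; elim: j => //= j IH u; exact: avg_ge0. Qed.

Lemma iter_nbavg_le1 f j : (forall u, f u <= 1) -> forall u, iter j nbavg f u <= 1.
Proof.
move=> f1; elim: j => //= j IH u.
exact: le_trans (avg_le (fun v _ => IH v)) (avg_cst_le _ _).
Qed.

Lemma degdec_ge0 u : 0 <= degdec u. Proof. by rewrite invr_ge0. Qed.

Lemma degdec_le1 u : degdec u <= 1.
Proof. by rewrite invf_le1 ?ler1n ?ltr0n ?leq_max. Qed.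

Lemma deg_degdec_le1 u : (deg A u)%:R * degdec u <= 1.
Proof. by rewrite ler_pdivrMr ?mul1r ?ler_nat ?ltr0n ?leq_maxr ?leq_max. Qed.

(** [rw_step] moves measures and [nbavg] moves functions; this duality turns a walk from a point
    mass into iterated averages of a function. *)
Lemma rw_step_adjoint q f :
  \sum_w rw_step A q w * f w = \sum_u q u * nbavg f u.
Proof.
rewrite /rw_step; under eq_bigr do rewrite mulr_suml.
rewrite exchange_big; apply: eq_bigr => u _ /=.
rewrite /nbavg /avg mulrA mulr_sumr [RHS]big_mkcond /=; apply: eq_bigr => w _.
by rewrite inE; case: ifP => _; rewrite ?mulr0 ?mul0r.
Qed.

Lemma iter_rw_step_adjoint q f j :
  \sum_w iter j (rw_step A) q w * f w = \sum_u q u * iter j nbavg f u.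
Proof.
elim: j f => //= j IH f.
by rewrite rw_step_adjoint IH -iterSr.
Qed.

(* The last step of a closed walk enters [v] with probability 1/deg of its
   previous vertex. *)
Lemma return_prob_le v j :
  0 <= return_prob R A v j.+1 <= iter j nbavg degdec v.
Proof.
have iter_ge0 : 0 <= iter j nbavg degdec v by apply/iter_nbavg_ge0/degdec_ge0.
rewrite /return_prob; case: ifPn => [|_]; first by rewrite lexx iter_ge0.
(* [k u] is the chance of stepping from [u] to [v]; the final [rw_step], evaluated at [v], is by
   definition the integral of [k]. *)
pose k u : R := if A (u, v) then (deg A u)%:R^-1 else 0.
have -> : iter j.+1 (rw_step A) (fun w => (w == v)%:R) v =
  \sum_w iter j (rw_step A) (fun w => (w == v)%:R) w * k w by [].
have k_ge0 u : 0 <= k u by rewrite /k; case: ifP => // _; rewrite invr_ge0.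
rewrite (iter_rw_step_adjoint _ k j) (bigD1 v)//= eqxx mul1r big1; last first.
  by move=> w /negPf ->; rewrite mul0r.
rewrite addr0 iter_nbavg_ge0//= iter_nbavg_mono// => u.
rewrite /k /degdec; case: ifPn => [Auv|_]; last by rewrite invr_ge0.
have du : (0 < deg A u)%N by rewrite card_gt0; apply/set0Pn; exists v; rewrite inE.
by rewrite (maxn_idPr du).
Qed.

Lemma vnorm_rw_vec_le k0 v : vnorm (rw_vec R A k0 v) <= 1.
Proof.
apply: vnorm_le => // i; rewrite mxE.
have /andP[r0 /le_trans r1] := return_prob_le v i.
by rewrite ger0_norm ?r1// iter_nbavg_le1//; exact: degdec_le1.
Qed.

End Walks.

(** * Bounds and Lipschitz continuity in the features, uniform in the graph *)

Section EvalBounds.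
Context {R : realType} {d k0 : nat}.
Local Notation ev := (@Defs.eval R d k0).

(** Return probabilities are at most 1, and a weighted mean never exceeds the bound on its values,
    whatever its positive weights. *)
Lemma eval_bounded k e (t : term R d k0 k e) (B : R) :
  exists C, 0 <= C /\ forall n (A : adj n) X u,
    (forall i, vnorm (X i) <= B) -> vnorm (ev A X t u) <= C.
Proof.
move: k e t; apply: term_tmean_ind => [k i|k e c|k i|k r es args IH e f fl|].
- by exists `|B|; split => // n A X u XB; exact: le_trans (XB _) (ler_norm _).
- by exists (vnorm c); split => //; exact: vnorm_ge0.
- by exists 1; split => // n A X u _; exact: vnorm_rw_vec_le.
- have [C CP] := choice IH; have [L L0 fL] := lipschitzN_sum fl.
  exists (L * (\sum_j C j) + vnorm (f (fun=> 0))); split.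
    by rewrite addr_ge0 ?vnorm_ge0// mulr_ge0// sumr_ge0// => j _; case: (CP j).
  move=> n A X u XB /=; set x := fun j => _.
  rewrite -[f x](subrK (f (fun=> 0))); apply: le_trans (vnormD _ _) _.
  rewrite lerD2r; apply: le_trans (fL _ _) _; rewrite ler_wpM2l// ler_sum// => j _.
  by rewrite subr0; apply: (CP j).2.
move=> k o e rho [C [C0 CP]] e' eta _ h hp hl.
exists C; split => // n A X u XB; apply: vnorm_le => // i; rewrite eval_tmean.
apply: ler_norm_wmean => // v _.
by apply: le_trans (coord_le_vnorm _ _) (CP _ _ _ _ _).
Qed.

(** This transfers results from quantized features to the actual ones. By [eval_bounded] the
    arguments of [h] stay in one ball, where [h] is Lipschitz and bounded below by a positive
    constant. *)
Lemma eval_lipschitz k e (t : term R d k0 k e) (B : R) :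
  exists L, 0 <= L /\ forall n (A : adj n) X Y u delta, 0 <= delta ->
    (forall i, vnorm (X i) <= B) -> (forall i, vnorm (Y i) <= B) ->
    (forall i, vnorm (X i - Y i) <= delta) ->
    vnorm (ev A X t u - ev A Y t u) <= L * delta.
Proof.
move: k e t; apply: term_tmean_ind => [k i|k e c|k i|k r es args IH e f fl|].
- by exists 1; split => // n A X Y u D D0 _ _ XY /=; rewrite mul1r.
- by exists 0; split => // n A X Y u D D0 _ _ XY /=; rewrite subrr vnorm0 mul0r.
- by exists 0; split => // n A X Y u D D0 _ _ XY /=; rewrite subrr vnorm0 mul0r.
- have [C CP] := choice IH; have [L L0 fL] := lipschitzN_sum fl.
  exists (L * (\sum_j C j)); split.
    by rewrite mulr_ge0// sumr_ge0// => j _; case: (CP j).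
  move=> n A X Y u D D0 XB YB XY /=; apply: le_trans (fL _ _) _.
  rewrite -mulrA ler_wpM2l// mulr_suml ler_sum// => j _.
  exact: (CP j).2.
move=> k o e rho [Lr [Lr0 LrP]] e' eta [Le [Le0 LeP]] h hp hl.
have [C [C0 CP]] := eval_bounded rho B.
have [E [E0 EP]] := eval_bounded eta B.
have [m [H [L [m0 H0 L0 mhH hL]]]] := pos_lipschitz_bounds E hp hl.
exists (m^-1 * (H * Lr + C * (L * Le) + C * (L * Le))); split.
  by rewrite mulr_ge0 ?invr_ge0 ?(ltW m0)// !addr_ge0// !mulr_ge0.
move=> n A X Y u D D0 XB YB XY; apply: vnorm_le => [|i].
  by rewrite !mulr_ge0 ?invr_ge0 ?(ltW m0)// !addr_ge0// !mulr_ge0.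
rewrite !mxE !eval_tmean.
have [->|V0] := eqVneq (scope A o u) finset.set0.
  rewrite /wmean !big_set0 !mul0r subr0 normr0.
  by rewrite !mulr_ge0 ?invr_ge0 ?(ltW m0)// !addr_ge0// !mulr_ge0.
apply: le_trans (@wmean_lipschitz _ _ _ _ _ _ _ m C H (Lr * D) (L * (Le * D)) V0 m0
  _ _ _ _ _) _ => [v _|v _|v _|v _|v _|].
- by apply: mhH; exact: EP.
- exact: hp.
- exact: le_trans (coord_le_vnorm _ _) (CP _ _ _ _ YB).
- have := coord_le_vnorm (ev A X rho (ext u v) - ev A Y rho (ext u v)) i.
  by rewrite !mxE => /le_trans; apply; exact: LrP.
- apply: le_trans (hL _ _ _ _ _) _; try exact: EP.
  by rewrite ler_wpM2l//; exact: LeP.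
by rewrite -mulrA ler_wpM2l ?invr_ge0 ?(ltW m0)// le_eqVlt; apply/orP; left; apply/eqP; ring.
Qed.

End EvalBounds.

(** * Random patterns of nodes *)

(* How each node variable is drawn: uniformly from all nodes ([None]), or
   uniformly from the neighbourhood of an earlier variable ([Some i]). *)
Inductive pat : nat -> Type :=
| PNil : pat 0
| PCons k : pat k -> option 'I_k -> pat k.+1.

Section Patterns.
Context {R : realType} {n : nat} (A : adj n).

(** A variable drawn from an empty neighbourhood contributes 0, so the total mass can be below 1 and
    constants satisfy only the inequality [pavg_cst_le]. *)
Fixpoint pavg k (pi : pat k) : (('I_k -> 'I_n) -> R) -> R :=
  match pi in pat k return (('I_k -> 'I_n) -> R) -> R with
  | PNil => fun F => F (no_nodes n)
  | PCons k pi o =>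
      fun F => pavg pi (fun u => avg (scope A o u) (fun v => F (ext u v)))
  end.

Lemma pavg_le k (pi : pat k) F F' : (forall u, F u <= F' u) ->
  pavg pi F <= pavg pi F'.
Proof.
elim: pi F F' => [|{}k pi IH o] F F' FF' //=.
by apply: IH => u; apply: avg_le.
Qed.

Lemma eq_pavg k (pi : pat k) F F' : (forall u, F u = F' u) ->
  pavg pi F = pavg pi F'.
Proof.
by move=> FF'; apply/le_anti; rewrite !pavg_le// => u; rewrite FF'.
Qed.

Lemma pavgD k (pi : pat k) F F' :
  pavg pi (fun u => F u + F' u) = pavg pi F + pavg pi F'.
Proof.
elim: pi F F' => [|{}k pi IH o] F F' //=.
by rewrite -IH; apply: eq_pavg => u; rewrite avgD.
Qed.

Lemma pavgZ k (pi : pat k) c F : pavg pi (fun u => c * F u) = c * pavg pi F.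
Proof.
elim: pi F => [|{}k pi IH o] F //=.
by rewrite -IH; apply: eq_pavg => u; rewrite avgZ.
Qed.

Lemma pavg_cst_le k (pi : pat k) c : 0 <= c -> pavg pi (fun=> c) <= c.
Proof.
move=> c0; elim: pi => //= {}k pi IH o; apply: le_trans IH.
by apply: pavg_le => u; exact: avg_cst_le.
Qed.

Lemma pavg_sum k (pi : pat k) (J : finType) (F : J -> ('I_k -> 'I_n) -> R) :
  pavg pi (fun u => \sum_j F j u) = \sum_j pavg pi (F j).
Proof.
elim: pi F => [|{}k pi IH o] F //=.
by rewrite -IH; apply: eq_pavg => u; rewrite avg_sum.
Qed.

Definition lowdeg (a : nat) : R := avg [set: 'I_n] (fun u => (deg A u < a)%N%:R).

(** Both sides sum [f v] over the ordered adjacent pairs [(w, v)]; symmetry of [A] permits grouping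
    them by either end. *)
Lemma sum_deg_nbavg (f : 'I_n -> R) : simple_graph A ->
  \sum_w (deg A w)%:R * nbavg A f w = \sum_w (deg A w)%:R * f w.
Proof.
case/andP => _ /forallP symA.
transitivity (\sum_w \sum_(v in nbhd A w) f v).
  apply: eq_bigr => w _; rewrite /nbavg /avg /deg.
  have [->|/set0Pn[v vw]] := eqVneq (nbhd A w) finset.set0.
    by rewrite big_set0 !mulr0.
  by rewrite mulVKf// pnatr_eq0 -lt0n card_gt0; apply/set0Pn; exists v.
transitivity (\sum_w \sum_v if A (w, v) then f v else 0).
  by apply: eq_bigr => w _; rewrite big_mkcond; apply: eq_bigr => v _; rewrite inE.
rewrite exchange_big; apply: eq_bigr => v _ /=.
rewrite -big_mkcond sumr_const mulr_natl; congr (_ *+ _).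
by apply: eq_card => w; rewrite inE unfold_in; have /forallP/(_ v)/eqP := symA w.
Qed.

Lemma sum_deg_iter_nbavg (f : 'I_n -> R) j : simple_graph A ->
  \sum_w (deg A w)%:R * iter j (nbavg A) f w = \sum_w (deg A w)%:R * f w.
Proof. by move=> sA; elim: j => //= j IH; rewrite sum_deg_nbavg. Qed.

(* The degree is an invariant measure of the walk, and off the nodes of degree
   less than [a] the uniform measure is at most [a^-1] times this measure. *)
Lemma pavg_coord_le a k (pi : pat k) i (f : 'I_n -> R) :
  simple_graph A -> (0 < n)%N -> (0 < a)%N -> (forall u, 0 <= f u <= 1) ->
  pavg pi (fun u => f (u i)) <=
    lowdeg a + a%:R^-1 * (n%:R^-1 * \sum_w (deg A w)%:R * f w).
Proof.
move=> sA n0 a0; elim: pi i f => [[]//|{}k pi IH o] i f f01 /=.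
have f0 u : 0 <= f u by case/andP: (f01 u).
have f1 u : f u <= 1 by case/andP: (f01 u).
rewrite /ext; case: (unlift ord_max i) => [i'|].
  (* An earlier variable: the last average runs over a constant and can only lose mass. *)
  apply: le_trans (IH i' f f01); apply: pavg_le => u; exact: avg_cst_le.
case: o => [j|] /=.
  (* The new variable is a random neighbour of [x_j], so its mean is that of [nbavg A f] at [x_j],
     and the degree-weighted sum does not change. *)
  rewrite -sum_deg_nbavg//; apply: (IH j (nbavg A f)) => u.
  apply/andP; split; first exact: avg_ge0.
  exact: (@iter_nbavg_le1 _ _ A f 1).
apply: le_trans (pavg_cst_le _ _) _; first exact: avg_ge0.
have -> : n%:R^-1 * (\sum_w (deg A w)%:R * f w) =
    avg [set: 'I_n] (fun w => (deg A w)%:R * f w).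
  by rewrite /avg cardsT card_ord; congr (_ * _); apply: eq_bigl => w; rewrite inE.
rewrite -avgZ -avgD; apply: avg_le => w _.
have [dw|dw] := ltnP (deg A w) a.
  by rewrite ler_wpDr// !mulr_ge0// invr_ge0.
rewrite add0r mulrA ler_peMl// mulrC ler_pdivlMr ?ltr0n// mul1r.
by rewrite ler_nat.
Qed.

(** Invariance of the degree measure removes the [j] steps, and [deg * degdec <= 1] at each node
    leaves a mean of at most 1. *)
Lemma pavg_iter_nbavg_degdec a k (pi : pat k) i j :
  simple_graph A -> (0 < n)%N -> (0 < a)%N ->
  pavg pi (fun u => iter j (nbavg A) (degdec A) (u i)) <= lowdeg a + a%:R^-1.
Proof.
move=> sA n0 a0.
apply: le_trans (pavg_coord_le pi i sA n0 a0 _) _ => [u|].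
  by rewrite iter_nbavg_ge0 ?iter_nbavg_le1//;
    [exact: degdec_le1|exact: degdec_ge0].
rewrite lerD2l sum_deg_iter_nbavg// ler_piMr ?invr_ge0//.
rewrite ler_pdivrMl ?ltr0n// mulr1 -[in leRHS](card_ord n) -sumr_const.
by apply: ler_sum => w _; exact: deg_degdec_le1.
Qed.

End Patterns.

(** * Finite product weights *)

Section ProductWeights.
Context {R : realType} {S : finType} (w : S -> R) {n : nat}.
Hypothesis w_ge0 : forall b, 0 <= w b.
Hypothesis w_sum1 : \sum_b w b = 1.
Implicit Types (x : {ffun 'I_n -> S}) (F : {ffun 'I_n -> S} -> R).

Definition pw x : R := \prod_i w (x i).
Definition Ex F : R := \sum_x pw x * F x.

Lemma pw_ge0 x : 0 <= pw x. Proof. exact: prodr_ge0. Qed.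

Lemma pw_sum1 : \sum_x pw x = 1.
Proof. by rewrite /pw -(bigA_distr_bigA (fun _ => w)) big1. Qed.

Lemma Ex_le F F' : (forall x, F x <= F' x) -> Ex F <= Ex F'.
Proof. by move=> FF'; apply: ler_sum => x _; rewrite ler_wpM2l ?pw_ge0. Qed.

Lemma eq_Ex F F' : (forall x, F x = F' x) -> Ex F = Ex F'.
Proof. by move=> FF'; apply: eq_bigr => x _; rewrite FF'. Qed.

Lemma ExD F F' : Ex (fun x => F x + F' x) = Ex F + Ex F'.
Proof. by rewrite /Ex -big_split; apply: eq_bigr => x _; rewrite mulrDr. Qed.

Lemma ExZ c F : Ex (fun x => c * F x) = c * Ex F.
Proof. by rewrite /Ex mulr_sumr; apply: eq_bigr => x _; rewrite mulrCA. Qed.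

Lemma Ex_cst c : Ex (fun=> c) = c.
Proof. by rewrite /Ex -mulr_suml pw_sum1 mul1r. Qed.

Lemma Ex_sum (J : finType) (P : pred J) (F : J -> {ffun 'I_n -> S} -> R) :
  Ex (fun x => \sum_(j | P j) F j x) = \sum_(j | P j) Ex (F j).
Proof.
by rewrite /Ex exchange_big; apply: eq_bigr => x _; rewrite mulr_sumr.
Qed.

Definition upd x (v : 'I_n) (b : S) : {ffun 'I_n -> S} :=
  [ffun i => if i == v then b else x i].

(** Exchanging the letter at [v] with an independent fresh one is an involution of words paired with
    a letter, and it preserves the product weight. *)
Lemma Ex_resample v F : Ex F = Ex (fun x => \sum_b w b * F (upd x v b)).
Proof.
pose swap (p : {ffun 'I_n -> S} * S) := (upd p.1 v p.2, p.1 v).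
have swapK : involutive swap.
  move=> [x b]; rewrite /swap /= ffunE eqxx; congr pair.
  by apply/ffunP => i; rewrite !ffunE; case: eqP => [->|].
have pw_upd x b : pw (upd x v b) * w (x v) = pw x * w b.
  rewrite /pw (bigD1 v)//= [in RHS](bigD1 v)//= ffunE eqxx.
  rewrite (eq_bigr (fun i => w (x i))) => [|i /negPf iv]; first by ring.
  by rewrite ffunE iv.
transitivity (\sum_x \sum_b pw x * w b * F (upd x v b)); last first.
  by apply: eq_bigr => x _; rewrite mulr_sumr; apply: eq_bigr => b _; rewrite mulrA.
rewrite pair_bigA /= (reindex_inj (inv_inj swapK)) /=.
rewrite -(pair_bigA _ (fun x b => pw (upd x v b) * w (x v) *
  F (upd (upd x v b) v (x v)))) /=.
apply: eq_bigr => x _.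
have updK b : upd (upd x v b) v (x v) = x by have := congr1 fst (swapK (x, b)).
under eq_bigr do rewrite pw_upd updK mulrAC.
by rewrite -mulr_sumr w_sum1 mulr1.
Qed.

(** * A law of large numbers over a set of nodes *)

Section LawOfLargeNumbers.
Variables (k : nat) (u : 'I_k -> 'I_n) (psi : ('I_k -> S) -> S -> R) (B : R).
Hypothesis psiB : forall a b, `|psi a b| <= B.
Implicit Types (v : 'I_n).

Let mean (a : 'I_k -> S) : R := \sum_b w b * psi a b.
Let fluct x v : R := psi (x \o u) (x v) - mean (x \o u).

Let meanB a : `|mean a| <= B.
Proof.
apply: le_trans (ler_norm_sum _ _ _) _; rewrite -[leRHS]mul1r -w_sum1 mulr_suml.
by apply: ler_sum => b _; rewrite normrM ger0_norm// ler_wpM2l.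
Qed.

Let fluctB x v : `|fluct x v| <= B + B.
Proof. by apply: le_trans (ler_normB _ _) _; rewrite lerD. Qed.

(** Resampling the letter at [v] changes neither the letters at [u] nor the one at [v'], while the
    fluctuation at [v] has mean 0 over the fresh letter. *)
Let fluct_orthogonal v v' : v != v' -> (forall i, u i != v) ->
  Ex (fun x => fluct x v * fluct x v') = 0.
Proof.
move=> vv' uv; rewrite (Ex_resample v) -[RHS](Ex_cst 0); apply: eq_Ex => x.
have xu b : upd x v b \o u = x \o u.
  by apply/funext => i /=; rewrite ffunE (negPf (uv i)).
transitivity (fluct x v' * \sum_b w b * (psi (x \o u) b - mean (x \o u))).
  rewrite mulr_sumr; apply: eq_bigr => b _.
  rewrite /fluct xu !ffunE eqxx eq_sym (negPf vv'); ring.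
under [X in _ * X]eq_bigr do rewrite mulrBr.
by rewrite sumrB -mulr_suml w_sum1 mul1r subrr mulr0.
Qed.

(** The last factor is at least 1 exactly for the pairs that [fluct_orthogonal] leaves out; summed
    over all [v] it gives [1 + k]. *)
Let fluct_cov v v' : Ex (fun x => fluct x v * fluct x v') <=
  (B + B) ^+ 2 * ((v == v')%:R + \sum_i (u i == v)%:R).
Proof.
have le1 : Ex (fun x => fluct x v * fluct x v') <= (B + B) ^+ 2.
  rewrite -[leRHS]Ex_cst; apply: Ex_le => x.
  by apply: le_trans (ler_norm _) _; rewrite normrM expr2 ler_pM.
have sum0 : 0 <= \sum_i (u i == v)%:R :> R by exact: sumr_ge0.
have [vv'|vv'] := eqVneq v v'.
  by apply: le_trans le1 _; rewrite ler_peMr ?sqr_ge0// lerDl.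
rewrite add0r; have [/existsP[i ui]|/existsPn uv] := boolP [exists i, u i == v].
  apply: le_trans le1 _; rewrite ler_peMr ?sqr_ge0// (bigD1 i)//= ui.
  by rewrite lerDl sumr_ge0.
by rewrite fluct_orthogonal// mulr_ge0 ?sqr_ge0.
Qed.

(* Second moment method; [|y| <= eps + y^2 / eps] avoids square roots. *)
Lemma Ex_avg_dist (V : {set 'I_n}) eps : V != finset.set0 -> 0 < eps ->
  Ex (fun x => `|avg V (fun v => psi (x \o u) (x v)) -
                 \sum_b w b * psi (x \o u) b|) <=
  eps + eps^-1 * ((B + B) ^+ 2 * (1 + k%:R)) * #|V|%:R^-1.
Proof.
move=> V0 e0.
have absle (y : R) : `|y| <= eps + eps^-1 * (y * y).
  have [ye|ye] := leP `|y| eps.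
    by rewrite ler_wpDr// mulr_ge0 ?invr_ge0 ?(ltW e0)// -expr2 sqr_ge0.
  rewrite ler_wpDl ?(ltW e0)// -expr2 -real_normK ?num_real// expr2 mulrA.
  by rewrite ler_peMl// mulrC ler_pdivlMr// mul1r ltW.
apply: (@le_trans _ _ (Ex (fun x =>
    eps + eps^-1 * (avg V (fluct x) * avg V (fluct x))))).
  apply: Ex_le => x; apply: le_trans (absle _) _.
  by rewrite /fluct avgB avg_cst.
rewrite ExD Ex_cst ExZ lerD2l -mulrA ler_wpM2l ?invr_ge0 ?(ltW e0)//.
have cV : 0 < #|V|%:R :> R by rewrite ltr0n card_gt0.
have -> : Ex (fun x => avg V (fluct x) * avg V (fluct x)) =
    #|V|%:R^-1 * (#|V|%:R^-1 *
      \sum_(v' in V) \sum_(v in V) Ex (fun x => fluct x v * fluct x v')).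
  under [in RHS]eq_bigr do rewrite -Ex_sum.
  rewrite -Ex_sum -!ExZ; apply: eq_Ex => x; rewrite /avg mulrACA -mulrA.
  congr (_ * (_ * _)); rewrite mulrC mulr_suml; apply: eq_bigr => v' _.
  by rewrite mulr_sumr; apply: eq_bigr => v _; rewrite mulrC.
rewrite mulrC ler_wpM2r ?invr_ge0 ?(ltW cV)// ler_pdivrMl//.
rewrite mulr_natl -sumr_const; apply: ler_sum => v' _.
apply: le_trans (ler_sum _ (fun v _ => fluct_cov v v')) _.
rewrite -mulr_sumr ler_wpM2l ?sqr_ge0//.
apply: (@le_trans _ _ (\sum_v ((v == v')%:R + \sum_i (u i == v)%:R))).
  rewrite [leLHS]big_mkcond; apply: ler_sum => v _; case: ifP => // _.
  by rewrite addr_ge0// sumr_ge0.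
rewrite big_split /= exchange_big /=; apply: lerD.
  by rewrite (bigD1 v')//= eqxx big1 ?addr0// => v /negPf->.
rewrite -[k in k%:R]card_ord -sumr_const; apply: ler_sum => i _.
under eq_bigr do rewrite eq_sym.
by rewrite (bigD1 (u i))//= eqxx big1 ?addr0// => v /negPf->.
Qed.

(** For empty [V] the average is 0 and the error is at most [|B|]; since [maxn 1 #|V|] is then 1,
    adding [|B|] to the constant covers this case. *)
Lemma Ex_avg_dist_all (V : {set 'I_n}) eps : 0 < eps ->
  Ex (fun x => `|avg V (fun v => psi (x \o u) (x v)) -
                 \sum_b w b * psi (x \o u) b|) <=
  eps + (eps^-1 * ((B + B) ^+ 2 * (1 + k%:R)) + `|B|) * (maxn 1 #|V|)%:R^-1.
Proof.
move=> e0; have K0 : 0 <= eps^-1 * ((B + B) ^+ 2 * (1 + k%:R)).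
  by rewrite mulr_ge0 ?invr_ge0 ?(ltW e0)// mulr_ge0 ?sqr_ge0 ?addr_ge0.
have [->|V0] := eqVneq V finset.set0; last first.
  have -> : maxn 1 #|V| = #|V| by apply/maxn_idPr; rewrite card_gt0.
  apply: le_trans (Ex_avg_dist V0 e0) _.
  by rewrite lerD2l ler_wpM2r ?invr_ge0// lerDl.
rewrite cards0 maxn0 invr1 mulr1 ler_wpDl ?(ltW e0)// ler_wpDl//.
rewrite -[leRHS]Ex_cst; apply: Ex_le => x.
rewrite /avg big_set0 mulr0 sub0r normrN.
exact: le_trans (meanB _) (ler_norm _).
Qed.

End LawOfLargeNumbers.
End ProductWeights.

(** * Approximation of terms by functions of the letters *)

Section MainEstimate.
Context {R : realType} {d k0 : nat} {S : finType} (w : S -> R).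
Hypothesis w_ge0 : forall b, 0 <= w b.
Hypothesis w_sum1 : \sum_b w b = 1.
Variables (c : S -> 'rV[R]_d) (B : R).
Hypothesis cB : forall b, vnorm (c b) <= B.
Local Notation ev := (@Defs.eval R d k0).

Section Epat.
Context {n : nat} (A : adj n) {k : nat} (pi : pat k).
Implicit Types F : {ffun 'I_n -> S} -> ('I_k -> 'I_n) -> R.

Definition Epat F : R := Ex w (fun x => pavg A pi (F x)).

Lemma Epat_le F F' : (forall x u, F x u <= F' x u) -> Epat F <= Epat F'.
Proof. by move=> FF'; apply: Ex_le => // x; exact: pavg_le. Qed.

Lemma EpatD F F' : Epat (fun x u => F x u + F' x u) = Epat F + Epat F'.
Proof. by rewrite /Epat -ExD; apply: eq_Ex => x; exact: pavgD. Qed.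

Lemma EpatZ a F : Epat (fun x u => a * F x u) = a * Epat F.
Proof. by rewrite /Epat -ExZ; apply: eq_Ex => x; exact: pavgZ. Qed.

Lemma Epat_sum (J : finType) (F : J -> {ffun 'I_n -> S} -> ('I_k -> 'I_n) -> R) :
  Epat (fun x u => \sum_j F j x u) = \sum_j Epat (F j).
Proof. by rewrite /Epat -Ex_sum; apply: eq_Ex => x; exact: pavg_sum. Qed.

Lemma Epat_cst_le a : 0 <= a -> Epat (fun _ _ => a) <= a.
Proof.
move=> a0; rewrite -[leRHS](Ex_cst w_sum1 (n := n)).
by apply: Ex_le => // x; exact: pavg_cst_le.
Qed.

Lemma Epat_exchange F : Epat F = pavg A pi (fun u => Ex w (fun x => F x u)).
Proof. by rewrite /Ex pavg_sum; apply: eq_bigr => x _; rewrite pavgZ. Qed.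

Lemma Epat_det (f : ('I_k -> 'I_n) -> R) : Epat (fun=> f) = pavg A pi f.
Proof. by rewrite /Epat Ex_cst. Qed.

End Epat.

(** The first two terms bound the mean inverse degree at any variable of a pattern; the last is the
    inverse number of nodes, for global means. *)
Definition sparsity n (A : adj n) (a : nat) : R :=
  lowdeg A a + a%:R^-1 + n%:R^-1.

Lemma pavg_scope n (A : adj n) a k (pi : pat k) o :
  simple_graph A -> (0 < n)%N -> (0 < a)%N ->
  pavg A pi (fun u => (maxn 1 #|scope A o u|)%:R^-1) <= sparsity A a.
Proof.
move=> sA n0 a0; case: o => [i|] /=.
  apply: le_trans (pavg_iter_nbavg_degdec pi i 0 sA n0 a0) _.
  by rewrite lerDl invr_ge0.
rewrite cardsT card_ord (maxn_idPr n0).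
apply: le_trans (pavg_cst_le _ _ _) _; rewrite ?invr_ge0//.
by rewrite lerDr !addr_ge0 ?invr_ge0 ?avg_ge0.
Qed.

Lemma comp_ext n k (x : {ffun 'I_n -> S}) (u : 'I_k -> 'I_n) v :
  x \o ext u v = ext (x \o u) (x v).
Proof. by apply/funext => i; rewrite /= /ext; case: (unlift _ _). Qed.

(** All patterns are quantified at once because a mean extends the pattern by the variable it binds.
    [C] depends on [eps] but not on the graph, which enters only through [sparsity]. *)
Definition approximates k e (t : term R d k0 k e) (phi : ('I_k -> S) -> 'rV[R]_e) :=
  forall eps, 0 < eps -> exists C, 0 <= C /\
    forall n (A : adj n) a (pi : pat k),
      simple_graph A -> (0 < n)%N -> (0 < a)%N ->
      Epat A pi (fun x u => vnorm (ev A (c \o x) t u - phi (x \o u))) <=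
        eps + C * sparsity A a.

Lemma approximates_exact k e (t : term R d k0 k e) phi :
  (forall n (A : adj n) (x : {ffun 'I_n -> S}) u,
     ev A (c \o x) t u = phi (x \o u)) -> approximates t phi.
Proof.
move=> tphi eps e0; exists 0; split => // n A a pi _ _ _.
rewrite mul0r addr0; apply: le_trans _ (ltW e0).
rewrite -[leRHS]/0; apply: le_trans (Epat_cst_le A pi (lexx 0)).
by apply: Epat_le => x u; rewrite tphi subrr vnorm0.
Qed.

Lemma approximates_rw k i : approximates (TRw R d k0 i) (fun _ : 'I_k -> S => 0).
Proof.
move=> eps e0; exists k0%:R; split => // n A a pi sA n0 a0.
apply: ler_wpDl; first exact: ltW.
apply: (@le_trans _ _ (Epat A pi (fun x u =>
    \sum_(j < k0) iter j (nbavg A) (degdec A) (u i)))).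
  apply: Epat_le => x u; rewrite subr0; apply: le_trans (vnorm_le_sum _) _.
  apply: ler_sum => j _; rewrite mxE.
  by have /andP[r0 r1] := @return_prob_le R _ A (u i) j; rewrite ger0_norm.
rewrite Epat_sum mulr_natl -[k0 in leRHS]card_ord -sumr_const.
apply: ler_sum => j _; rewrite Epat_det.
apply: le_trans (pavg_iter_nbavg_degdec pi i j sA n0 a0) _.
by rewrite lerDl invr_ge0.
Qed.

Lemma approximates_app k r (es : 'I_r -> nat)
    (args : forall j, term R d k0 k (es j)) phi e
    (f : (forall j : 'I_r, 'rV[R]_(es j)) -> 'rV[R]_e) (fl : lipschitzN f) :
  (forall j, approximates (args j) (phi j)) ->
  approximates (TApp args fl) (fun a => f (fun j => phi j a)).
Proof.
move=> IH eps e0; have [L L0 fL] := lipschitzN_sum fl.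
have Lr0 : 0 < L * r%:R + 1 by rewrite ltr_wpDl// mulr_ge0.
(* The accuracy for each argument that makes the total at most [eps]; the added 1 covers
   [L * r = 0]. *)
have e'0 : 0 < eps / (L * r%:R + 1) by rewrite divr_gt0.
have [C CP] := choice (fun j => IH j _ e'0).
exists (L * \sum_j C j); split.
  by rewrite mulr_ge0// sumr_ge0// => j _; exact: (CP j).1.
move=> n A a pi sA n0 a0.
apply: (@le_trans _ _ (Epat A pi (fun x u =>
    L * \sum_j vnorm (ev A (c \o x) (args j) u - phi j (x \o u))))).
  by apply: Epat_le => x u; exact: fL.
rewrite EpatZ Epat_sum.
apply: (@le_trans _ _
    (L * \sum_(j < r) (eps / (L * r%:R + 1) + C j * sparsity A a))).
  by rewrite ler_wpM2l// ler_sum// => j _; exact: (CP j).2.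
rewrite big_split /= sumr_const card_ord -mulr_suml mulrDr (mulrA L) lerD2r.
have -> : L * ((eps / (L * r%:R + 1)) *+ r) = eps * ((L * r%:R) / (L * r%:R + 1)).
  by rewrite -mulr_natl; ring.
by rewrite ler_piMr ?(ltW e0)// ler_pdivrMr// mul1r lerDl.
Qed.

Section Mean.
Context {k : nat} (o : option 'I_k) {e : nat} (rho : term R d k0 k.+1 e)
  {e' : nat} (eta : term R d k0 k.+1 e') (h : 'rV[R]_e' -> 'rV[R]_e)
  (hp : pos_valued h) (hl : lipschitz_bdd h)
  (phir : ('I_k.+1 -> S) -> 'rV[R]_e) (phie : ('I_k.+1 -> S) -> 'rV[R]_e')
  (Cr Ce : R).
Hypothesis phirB : forall a, vnorm (phir a) <= Cr.
Hypothesis phieB : forall a, vnorm (phie a) <= Ce.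

Definition mean_num i (a : 'I_k -> S) : R :=
  \sum_b w b * (phir (ext a b) ord0 i * h (phie (ext a b)) ord0 i).
Definition mean_den i (a : 'I_k -> S) : R :=
  \sum_b w b * h (phie (ext a b)) ord0 i.
Definition mean_limit (a : 'I_k -> S) : 'rV[R]_e :=
  \row_i (mean_num i a / mean_den i a).

Lemma mean_den_gt0 i a : 0 < mean_den i a.
Proof.
have [m [H [L [m0 _ _ mhH _]]]] := pos_lipschitz_bounds Ce hp hl.
apply: lt_le_trans m0 _; rewrite -[leLHS]mul1r -w_sum1 mulr_suml.
apply: ler_sum => b _; rewrite ler_wpM2l//.
by case/andP: (mhH _ i (phieB (ext a b))).
Qed.

Lemma mean_ratio_le i a : `|mean_num i a / mean_den i a| <= Cr.
Proof.
rewrite normrM normfV (gtr0_norm (mean_den_gt0 i a)).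
rewrite ler_pdivrMr ?mean_den_gt0// mulr_sumr.
apply: le_trans (ler_norm_sum _ _ _) _; apply: ler_sum => b _.
rewrite !normrM (ger0_norm (w_ge0 b)) (gtr0_norm (hp _ _)) mulrCA.
rewrite ler_wpM2r// ?mulr_ge0 ?(ltW (hp _ _))//.
exact: le_trans (coord_le_vnorm _ _) (phirB _).
Qed.

Lemma vnorm_mean_limit a : 0 <= Cr -> vnorm (mean_limit a) <= Cr.
Proof. by move=> C0; apply: vnorm_le => // i; rewrite mxE mean_ratio_le. Qed.

(** Three errors occur. Those of [rho] and [eta], averaged over the bound variable, are errors for
    the pattern extended by [o]. The passage from nodes to letters is the law of large numbers. An
    empty neighbourhood costs at most [Cr], charged to the inverse size of the scope. *)
Lemma approximates_mean : 0 <= Cr ->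
  approximates rho phir -> approximates eta phie ->
  approximates (tmean o rho eta hp hl) mean_limit.
Proof.
move=> Cr0 IHr IHe eps e0.
have [E1 [E10 evB]] := eval_bounded eta B.
(* One ball contains the values of [eta] and those of [phie]. *)
have [m [H [L [m0 H0 L0 mhH hL]]]] := pos_lipschitz_bounds (Num.max E1 Ce) hp hl.
have phieM a : vnorm (phie a) <= Num.max E1 Ce by rewrite le_max phieB orbT.
have m1 : 0 <= m^-1 by rewrite invr_ge0 ltW.
(* [M], and [Q] below, collect the coefficients of [del] and of [sparsity] in the final sum; the
   factor [e] comes from summing over coordinates. *)
pose M : R := e%:R * (m^-1 * (H + (Cr * L + Cr * L) + 1 + Cr)).
have M0 : 0 <= M by rewrite !mulr_ge0// !addr_ge0// !mulr_ge0.
pose del := eps / (M + 1).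
have M10 : 0 < M + 1 by rewrite ltr_wpDl.
have d0 : 0 < del by rewrite divr_gt0.
have [C1 [C10 C1P]] := IHr _ d0; have [C2 [C20 C2P]] := IHe _ d0.
(* The constant of [Ex_avg_dist_all] at accuracy [del]. *)
pose K b : R := del^-1 * ((b + b) ^+ 2 * (1 + k%:R)) + `|b|.
have K0 b : 0 <= K b.
  rewrite addr_ge0// mulr_ge0 ?invr_ge0 ?(ltW d0)//.
  by rewrite mulr_ge0 ?sqr_ge0 ?addr_ge0.
pose Q := e%:R * (m^-1 * (H * C1 + (Cr * L + Cr * L) * C2 + K (Cr * H) +
   Cr * K H)).
have Q0 : 0 <= Q.
  apply: mulr_ge0 => //; apply: mulr_ge0 => //.
  apply: addr_ge0; [apply: addr_ge0; [apply: addr_ge0|exact: K0]|].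
  - exact: mulr_ge0.
  - by rewrite mulr_ge0 ?addr_ge0 ?mulr_ge0.
  - by rewrite mulr_ge0 ?K0.
(* The extra [Cr] pays for empty neighbourhoods. *)
exists (Cr + Q); split; first exact: addr_ge0.
move=> n A a pi sA n0 a0.
pose er (x : {ffun 'I_n -> S}) u := vnorm (ev A (c \o x) rho u - phir (x \o u)).
pose ee (x : {ffun 'I_n -> S}) u := vnorm (ev A (c \o x) eta u - phie (x \o u)).
pose V (u : 'I_k -> 'I_n) := scope A o u.
pose ar x u := avg (V u) (fun v => er x (ext u v)).
pose ae x u := avg (V u) (fun v => ee x (ext u v)).
pose psi1 i (a : 'I_k -> S) b := phir (ext a b) ord0 i * h (phie (ext a b)) ord0 i.
pose psi2 i (a : 'I_k -> S) b := h (phie (ext a b)) ord0 i.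
pose lln (psi : ('I_k -> S) -> S -> R) (x : {ffun 'I_n -> S}) u :=
  `|avg (V u) (fun v => psi (x \o u) (x v)) - \sum_b w b * psi (x \o u) b|.
have hbound i a' b : `|psi2 i a' b| <= H.
  rewrite ger0_norm; last by rewrite ltW// hp.
  by case/andP: (mhH _ i (phieM (ext a' b))).
have pointwise (x : {ffun 'I_n -> S}) (u : 'I_k -> 'I_n) : vnorm (ev A (c \o x) (tmean o rho eta hp hl) u -
      mean_limit (x \o u)) <=
    Cr * (maxn 1 #|V u|)%:R^-1 +
    \sum_(i < e) m^-1 * (H * ar x u + (Cr * L + Cr * L) * ae x u +
      lln (psi1 i) x u + Cr * lln (psi2 i) x u).
  have ar0 : 0 <= ar x u by apply: avg_ge0 => v _; exact: vnorm_ge0.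
  have ae0 : 0 <= ae x u by apply: avg_ge0 => v _; exact: vnorm_ge0.
  have lln0 psi : 0 <= lln psi x u by exact: normr_ge0.
  have term0 i : 0 <= m^-1 * (H * ar x u + (Cr * L + Cr * L) * ae x u +
      lln (psi1 i) x u + Cr * lln (psi2 i) x u).
    apply: mulr_ge0 => //; apply: addr_ge0; last by apply: mulr_ge0; rewrite ?lln0.
    apply: addr_ge0; last exact: lln0.
    apply: addr_ge0; first exact: mulr_ge0.
    by apply: mulr_ge0 => //; apply: addr_ge0; exact: mulr_ge0.
  have [V0|V0] := eqVneq (V u) finset.set0.
    apply: ler_wpDr; first by apply: sumr_ge0 => i _.
    rewrite V0 cards0 maxn0 invr1 mulr1; apply: vnorm_le => // i.
    rewrite !mxE eval_tmean -/(V u) V0 /wmean !big_set0 mul0r sub0r normrN.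
    exact: mean_ratio_le.
  apply: ler_wpDl; first by rewrite mulr_ge0 ?invr_ge0.
  apply: le_trans (vnorm_le_sum _) _; apply: ler_sum => i _.
  rewrite !mxE eval_tmean.
  apply: le_trans (wmean_error (r' := fun v => phir (x \o ext u v) ord0 i)
    (h' := fun v => h (phie (x \o ext u v)) ord0 i)
    (er := fun v => er x (ext u v)) (ee := fun v => ee x (ext u v))
    (m := m) (H := H) (C := Cr) (L := L)
    V0 m0 Cr0 _ _ _ _ (lt0r_neq0 (mean_den_gt0 i (x \o u)))
    (mean_ratio_le i (x \o u))) _.
  - by move=> v; apply: mhH; rewrite le_max evB// => j; exact: cB.
  - by move=> v; exact: le_trans (coord_le_vnorm _ _) (phirB _).
  - move=> v; rewrite /er.
    have := coord_le_vnorm (ev A (c \o x) rho (ext u v) - phir (x \o ext u v)) i.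
    by rewrite !mxE.
  - by move=> v; apply: hL => //; rewrite le_max evB// => j; exact: cB.
  rewrite ler_wpM2l//.
  under [in X in `|X - mean_num _ _|]eq_fun do rewrite comp_ext.
  under [in X in `|X - mean_den _ _|]eq_fun do rewrite comp_ext.
  by [].
apply: le_trans (Epat_le A pi pointwise) _.
have llnE i (psi : 'I_e -> ('I_k -> S) -> S -> R) b : (forall a b', `|psi i a b'| <= b) ->
    Epat A pi (lln (psi i)) <= del + K b * sparsity A a.
  move=> psib; rewrite Epat_exchange.
  apply: (@le_trans _ _ (pavg A pi (fun u => del + K b * (maxn 1 #|V u|)%:R^-1))).
    by apply: pavg_le => u; exact: Ex_avg_dist_all.
  rewrite pavgD pavgZ lerD ?pavg_cst_le ?(ltW d0)//.
  by rewrite ler_wpM2l//; exact: pavg_scope.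
rewrite EpatD EpatZ Epat_sum.
have -> : eps + (Cr + Q) * sparsity A a =
  Cr * sparsity A a + (eps + Q * sparsity A a) by ring.
apply: lerD; first by rewrite Epat_det ler_wpM2l// pavg_scope.
apply: (@le_trans _ _ (\sum_(i < e) m^-1 * (H * (del + C1 * sparsity A a) +
    (Cr * L + Cr * L) * (del + C2 * sparsity A a) +
    (del + K (Cr * H) * sparsity A a) + Cr * (del + K H * sparsity A a)))).
  apply: ler_sum => i _; rewrite EpatZ !EpatD !EpatZ ler_wpM2l//.
  apply: lerD; [apply: lerD; [apply: lerD|]|].
  (* [ar] and [ae] averaged over [pi] are by definition averages over [PCons pi o]. *)
  - by rewrite ler_wpM2l//; exact: (C1P n A a (PCons pi o)).
  - by rewrite ler_wpM2l ?addr_ge0 ?mulr_ge0//; exact: (C2P n A a (PCons pi o)).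
  - apply: (llnE i psi1) => a' b; rewrite normrM ler_pM//.
      exact: le_trans (coord_le_vnorm _ _) (phirB _).
    exact: hbound.
  - by rewrite ler_wpM2l//; apply: (llnE i psi2) => a' b; exact: hbound.
rewrite sumr_const card_ord -mulr_natl.
have -> : e%:R * (m^-1 * (H * (del + C1 * sparsity A a) +
    (Cr * L + Cr * L) * (del + C2 * sparsity A a) +
    (del + K (Cr * H) * sparsity A a) + Cr * (del + K H * sparsity A a))) =
  M * del + Q * sparsity A a by rewrite /M /Q; ring.
rewrite lerD2r /del mulrA ler_pdivrMr// mulrC ler_wpM2l ?(ltW e0)//.
by rewrite lerDl.
Qed.

End Mean.

(** The bound on [phi] belongs to the induction: a mean needs the limit of [eta] to stay in a ball
    on which [h] is controlled. *)
Theorem eval_approximable k e (t : term R d k0 k e) :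
  exists phi, (exists C, 0 <= C /\ forall a, vnorm (phi a) <= C) /\
    approximates t phi.
Proof.
move: k e t; apply: term_tmean_ind => [k i|k e z|k i|k r es args IH e f fl|].
- exists (fun a => c (a i)); split; last exact: approximates_exact.
  by exists `|B|; split => // a; exact: le_trans (cB _) (ler_norm _).
- exists (fun=> z); split; last exact: approximates_exact.
  by exists (vnorm z); split => //; exact: vnorm_ge0.
- exists (fun=> 0); split; last exact: approximates_rw.
  by exists 0; split => // a; rewrite vnorm0.
- pose phi j := sval (cid (IH j)).
  have phiP j : (exists C, 0 <= C /\ forall a, vnorm (phi j a) <= C) /\
      approximates (args j) (phi j) by exact: (svalP (cid (IH j))).
  exists (fun a => f (fun j => phi j a)); split; last first.
    by apply: approximates_app => j; exact: (phiP j).2.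
  have [C CP] := choice (fun j => (phiP j).1); have [L L0 fL] := lipschitzN_sum fl.
  exists (L * (\sum_j C j) + vnorm (f (fun=> 0))); split.
    by rewrite addr_ge0 ?vnorm_ge0// mulr_ge0// sumr_ge0// => j _; case: (CP j).
  move=> a; set y := fun j => _.
  rewrite -[f y](subrK (f (fun=> 0))); apply: le_trans (vnormD _ _) _.
  rewrite lerD2r; apply: le_trans (fL _ _) _; rewrite ler_wpM2l// ler_sum// => j _.
  by rewrite subr0; apply: (CP j).2.
move=> k o e rho [phir [[Cr [Cr0 phirB]] IHr]] e' eta [phie [[Ce [Ce0 phieB]] IHe]].
move=> h hp hl; exists (mean_limit h phir phie); split.
  by exists Cr; split => // a; apply: (vnorm_mean_limit hp hl phirB phieB).
exact: approximates_mean phirB phieB Cr0 IHr IHe.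
Qed.

End MainEstimate.

(** * Degrees in the Erdos-Renyi graph *)

Section ErdosRenyi.
Context {R : realType} {n : nat}.
Implicit Types (A : adj n) (x : 'I_n * 'I_n) (q : R).

Definition upper x : bool := (x.1 < x.2)%N.

Lemma card_upper : #|[set x | upper x]| = 'C(n, 2).
Proof.
rewrite -sum1_card (eq_bigl upper) => [|x]; last by rewrite inE.
rewrite -(pair_big_dep xpredT (fun i j : 'I_n => (i < j)%N) (fun _ _ => 1%N)) /=.
rewrite (exchange_big_dep xpredT) //= -bin2_sum big_mkord; apply: eq_bigr => j _.
rewrite -(big_ord_widen_cond _ xpredT (fun=> 1%N)) ?(ltnW (ltn_ord j))//.
by rewrite sum1_card card_ord.
Qed.

Lemma ER_prob_prod q A : simple_graph A ->
  ER_prob q A = \prod_(x | upper x) (if A x then q else 1 - q).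
Proof.
move=> sA; rewrite /ER_prob sA (bigID A) /=; congr (_ * _).
  rewrite (eq_bigr (fun=> q)); last by move=> x /andP[_ ->].
  rewrite prodr_const; congr (_ ^+ _); apply: eq_card => x.
  by rewrite inE unfold_in andbC.
rewrite (eq_bigr (fun=> 1 - q)); last by move=> x /andP[_ /negPf->].
rewrite prodr_const -card_upper; congr (_ ^+ _).
rewrite -(cardsID [set x | A x] [set x | upper x]).
have -> : nedges A = #|[set x | upper x] :&: [set x | A x]|.
  by apply: eq_card => x; rewrite !inE andbC.
by rewrite addKn; apply: eq_card => x; rewrite !inE unfold_in andbC.
Qed.

(** This is the independence of the edges: expanding the product of sums chooses a Boolean for each
    pair [i < j], and such choices correspond to simple graphs. *)
Lemma sum_simple_graph (F : 'I_n * 'I_n -> bool -> R) :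
  \sum_(A : adj n | simple_graph A) \prod_(x | upper x) F x (A x) =
  \prod_(x | upper x) (F x true + F x false).
Proof.
transitivity (\prod_(x | upper x) \sum_b F x b).
  rewrite (big_distr_big false) /=.
  pose swap (x : 'I_n * 'I_n) := (x.2, x.1).
  pose sym (f : adj n) : adj n :=
    [ffun x => (upper x && f x) || (upper (swap x) && f (swap x))].
  pose up (A : adj n) : adj n := [ffun x => upper x && A x].
  have symE f x : upper x -> sym f x = f x.
    rewrite /sym ffunE /upper /swap /= => ux; rewrite ux /=.
    by rewrite ltnNge (ltnW ux)/= orbF.
  (* [sym] symmetrizes a choice on the pairs [i < j] and [up] restricts a graph to them; between
     simple graphs and choices that are false elsewhere they are mutually inverse. *)
  rewrite (reindex_onto sym up) => [|A]; last first.
    case/andP => /forallP irr /forallP symA; apply/ffunP => -[i j].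
    rewrite /sym /up !ffunE /upper /swap /=; have /forallP/(_ j)/eqP Aij := symA i.
    case: (ltngtP i j) => [||/val_inj ->] //=; rewrite ?orbF//.
    by rewrite (negPf (irr j)).
  apply: eq_big => [f|f /andP[_ /eqP fE]]; last first.
    by apply: eq_bigr => x ux; rewrite symE.
  have -> : simple_graph (sym f).
    apply/andP; split; apply/forallP => i.
      by rewrite /sym ffunE /upper /= ltnn.
    by apply/forallP => j; rewrite /sym !ffunE /swap /= orbC.
  have upsym x : up (sym f) x = upper x && f x.
    by rewrite /up ffunE; case ux: (upper x); rewrite //= symE.
  apply/eqP/pffun_onP => [fE|[/supportP fE _]].
    split; last by [].
    by apply/supportP => x xu; rewrite -fE upsym; apply/negbTE; rewrite negb_and xu.
  apply/ffunP => x; rewrite upsym; case ux: (upper x) => //=.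
  by rewrite fE//; apply/negbT.
by apply: eq_bigr => x _; rewrite big_bool.
Qed.

Lemma sum_ER_prob q (F : 'I_n * 'I_n -> bool -> R) :
  \sum_(A : adj n) ER_prob q A * \prod_(x | upper x) F x (A x) =
  \prod_(x | upper x) (q * F x true + (1 - q) * F x false).
Proof.
rewrite -(sum_simple_graph (fun x b => (if b then q else 1 - q) * F x b)).
rewrite [RHS]big_mkcond; apply: eq_bigr => A _; case: ifPn => sA.
  by rewrite ER_prob_prod// -big_split.
by rewrite /ER_prob (negPf sA) mul0r.
Qed.

Lemma sum_ER_prob1 q : \sum_(A : adj n) ER_prob q A = 1.
Proof.
have := sum_ER_prob q (fun _ _ => 1); rewrite !mulr1 addrC subrK.
rewrite [in RHS]big1// => <-.
by apply: eq_bigr => A _; rewrite big1// mulr1.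
Qed.

Lemma ER_prob_ge0 q A : 0 <= q <= 1 -> 0 <= ER_prob q A.
Proof.
case/andP => q0 q1; rewrite /ER_prob; case: ifP => // _.
by rewrite mulr_ge0 ?exprn_ge0// subr_ge0.
Qed.

Lemma prod_upper_incident (u : 'I_n) (g : 'I_n -> R) :
  \prod_(x | upper x) ((if x.1 == u then g x.2 else 1) *
                       (if x.2 == u then g x.1 else 1)) =
  \prod_(j | j != u) g j.
Proof.
rewrite big_split /= (bigID (fun j : 'I_n => (u < j)%N)) /=; congr (_ * _).
  rewrite -(pair_big_dep xpredT (fun i j : 'I_n => (i < j)%N)
    (fun i j => if i == u then g j else 1)) /=.
  rewrite (bigD1 u)//= eqxx [X in _ * X]big1 ?mulr1 => [|i /negPf iu]; last first.
    by rewrite big1// => j _; rewrite iu.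
  by apply: eq_bigl => j; case: ltngtP => [||/val_inj->]; rewrite ?andbF ?andbT//;
    rewrite -val_eqE /= => uj; rewrite gtn_eqF.
rewrite -(pair_big_dep xpredT (fun i j : 'I_n => (i < j)%N)
  (fun i j => if j == u then g i else 1)) /= (exchange_big_dep xpredT)//=.
rewrite (bigD1 u)//= eqxx [X in _ * X]big1 ?mulr1 => [|i /negPf iu]; last first.
  by rewrite big1// => j _; rewrite iu.
by apply: eq_bigl => j; rewrite -leqNgt ltn_neqAle.
Qed.

Lemma expr_deg_prod A u (s : R) : simple_graph A ->
  s ^+ deg A u = \prod_(x | upper x)
    (if A x && ((x.1 == u) || (x.2 == u)) then s else 1).
Proof.
case/andP => /forallP irr /forallP symA.
transitivity (\prod_(j | j != u) if A (u, j) then s else 1).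
  rewrite /deg -prodr_const big_mkcond /= (bigD1 u)//= inE (negPf (irr u)) mul1r.
  by apply: eq_bigr => j _; rewrite inE.
rewrite -prod_upper_incident; apply: eq_bigr => -[i j]; rewrite /upper /= => ij.
have /forallP/(_ j)/eqP Aij := symA i.
have [iu|iu] := eqVneq i u; last first.
  rewrite /= mul1r; have [ju|ju] := eqVneq j u; rewrite ?andbF//.
  by rewrite andbT -ju Aij.
have ju : (j == u) = false by rewrite -val_eqE /= -iu; apply: gtn_eqF.
by rewrite ju mulr1 andbT iu.
Qed.

(** The generating function of a binomial degree: [s ^+ deg] is a product over the pairs, of which
    [n - 1] contain [u]. *)
Lemma sum_ER_prob_expr_deg q u (s : R) :
  \sum_(A : adj n) ER_prob q A * s ^+ deg A u = (1 - q + q * s) ^+ n.-1.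
Proof.
pose F (x : 'I_n * 'I_n) (b : bool) : R :=
  if b && ((x.1 == u) || (x.2 == u)) then s else 1.
transitivity (\sum_(A : adj n) ER_prob q A * \prod_(x | upper x) F x (A x)).
  apply: eq_bigr => A _; have [sA|sA] := boolP (simple_graph A).
    by rewrite expr_deg_prod.
  by rewrite /ER_prob (negPf sA) !mul0r.
rewrite sum_ER_prob.
transitivity (\prod_(j | j != u) (1 - q + q * s)); last first.
  by rewrite prodr_const cardC1 card_ord.
rewrite -prod_upper_incident; apply: eq_bigr => -[i j]; rewrite /upper /F /= => ij.
rewrite mulr1; have [iu|iu] := eqVneq i u.
  rewrite (_ : j == u = false) /=; first by rewrite mulr1 addrC.
  by rewrite -val_eqE /=; apply: gtn_eqF; rewrite -iu.
by rewrite mul1r; case: eqVneq => _ /=; rewrite addrC ?mulr1// subrK.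
Qed.

(** Induction with [(1 - y) (1 + (m + 1) y) <= 1 + m y]. Decay like [1 / (m y)] is enough, as
    [n p(n)] tends to infinity. *)
Lemma bernoulli_inv (y : R) m : 0 <= y <= 1 -> (1 - y) ^+ m <= (1 + m%:R * y)^-1.
Proof.
case/andP => y0 y1; have pos k : 0 < 1 + k%:R * y.
  by rewrite ltr_wpDr// mulr_ge0.
rewrite -[leRHS]mul1r ler_pdivlMr ?pos//.
elim: m => [|m IH]; first by rewrite expr0 mul0r addr0 mul1r.
apply: le_trans IH; rewrite exprSr -mulrA ler_wpM2l ?exprn_ge0 ?subr_ge0//.
rewrite -natr1; have m0 : 0 <= m%:R :> R by [].
have : 0 <= (m%:R + 1) * (y * y) by rewrite !mulr_ge0// addr_ge0.
by move=> h; rewrite -subr_ge0; apply: le_trans h _; rewrite le_eqVlt;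
  apply/orP; left; apply/eqP; ring.
Qed.

Lemma ER_lowdeg_le q a : 0 <= q <= 1 -> (0 < n)%N ->
  \sum_(A : adj n) ER_prob q A * lowdeg A a <=
    2 ^+ a * (1 + n.-1%:R * (q / 2))^-1.
Proof.
move=> q01 n0; have /andP[q0 q1] := q01.
apply: (@le_trans _ _ (\sum_(A : adj n) ER_prob q A *
    avg [set: 'I_n] (fun u => 2 ^+ a * 2^-1 ^+ deg A u))).
  apply: ler_sum => A _; rewrite ler_wpM2l ?ER_prob_ge0//; apply: avg_le => u _.
  have [du|_] := ltnP (deg A u) a; last by rewrite mulr_ge0 ?exprn_ge0.
  rewrite exprVn -expfB// exprn_ege1//; exact: ler1n.
under eq_bigr do rewrite avgZ mulrCA -avgZ.
rewrite -mulr_sumr ler_wpM2l ?exprn_ge0// -avg_sum.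
have -> : (fun u => \sum_(A : adj n) ER_prob q A * 2^-1 ^+ deg A u) =
    fun=> (1 - q / 2) ^+ n.-1.
  by apply/funext => u; rewrite sum_ER_prob_expr_deg; congr (_ ^+ _); field.
rewrite avg_cst; last by rewrite -card_gt0 cardsT card_ord.
by apply: bernoulli_inv; apply/andP; split; lra.
Qed.

End ErdosRenyi.

(** * Expected degrees in the three regimes *)

Section Growth.
Local Open Scope classical_set_scope.
Local Open Scope ring_scope.
Context {R : realType}.

Lemma edge_prob_growth (p : nat -> R) : edge_prob_regime p ->
  forall K, exists N, forall n, (N <= n)%N -> K <= n%:R * p n.
Proof.
move=> [p01 reg] K.
suff [N _ Np] : \forall n \near \oo, K <= n%:R * p n by exists N.
case: reg => [[q [q0 pq]]|[c [beta [c0 /andP[b0 b1] pE]]]|[c [c0 pE]]].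
- have q20 : 0 < q / 2 by rewrite divr_gt0.
  have pq2 : \forall n \near \oo, q / 2 < p n.
    by apply: cvgr_gt pq _ _; rewrite ltr_pdivrMr// mulr_natr mulr2n ltrDl.
  near=> n; apply: (@le_trans _ _ (n%:R * (q / 2))).
    rewrite -ler_pdivrMr//; near: n; exact: nbhs_infty_ger.
  by rewrite ler_wpM2l// ltW//; near: n.
- have e0 : 0 < 1 - beta by rewrite subr_gt0.
  near=> n.
  have n1 : (0 < n)%N by near: n; exact: nbhs_infty_gt.
  have n0 : 0 < n%:R :> R by rewrite ltr0n.
  have -> : p n = c * (n%:R `^ (- beta)) by near: n.
  rewrite mulrCA -{1}(powRr1 (ltW n0)) -powRD; last by rewrite gt_eqF// implybT.
  rewrite mulrC -ler_pdivrMr//.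
  (* A nonpositive [K / c] is treated apart, because it cannot be written as a power of its root. *)
  have [Kn|Kp] := leP (K / c) 0; first by apply: le_trans Kn _; exact: powR_ge0.
  have -> : K / c = (K / c) `^ ((1 - beta)^-1) `^ (1 - beta).
    by rewrite -powRrM mulVf ?gt_eqF// powRr1// ltW.
  rewrite ge0_ler_powR ?nnegrE ?powR_ge0 ?(ltW e0)//.
  near: n; exact: nbhs_infty_ger.
- near=> n.
  have n1 : (0 < n)%N by near: n; exact: nbhs_infty_gt.
  have n0 : 0 < n%:R :> R by rewrite ltr0n.
  have -> : p n = c * (ln n%:R / n%:R) by near: n.
  have -> : n%:R * (c * (ln n%:R / n%:R)) = ln (n%:R : R) * c.
    by field; rewrite gt_eqF.
  rewrite -ler_pdivrMr// -[leLHS]expRK ler_ln ?posrE ?expR_gt0//.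
  near: n; exact: nbhs_infty_ger.
Unshelve. all: by end_near. Qed.

End Growth.

(** * Measurability and quantization *)

Section FiniteFibers.
Local Open Scope classical_set_scope.
Local Open Scope ring_scope.
Context {R : realType} {dT : measure_display} {T : measurableType dT}.
Context {S : finType} (Y : T -> S).

Lemma measurable_fibers (D : set T) :
  (forall a, measurable (D `&` Y @^-1` [set a])) -> measurable D.
Proof.
move=> mF; have -> : D = \bigcup_(a in setT) (D `&` Y @^-1` [set a]).
  by apply/seteqP; split => [x Dx|x [a _ []]//]; exists (Y x).
by apply: fin_bigcup_measurable => //; exact: finite_finset.
Qed.

Lemma measure_fibers (mu : {measure set T -> \bar R}) (D : set T) :
  (forall a, measurable (D `&` Y @^-1` [set a])) ->
  mu D = (\sum_a mu (D `&` Y @^-1` [set a]))%E.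
Proof.
move=> mF; pose F a := D `&` Y @^-1` [set a].
have {1}-> : D = \big[setU/set0]_(a <- index_enum S) F a.
  rewrite -bigcup_seq; apply/seteqP; split => [x Dx|x [a _ []]//].
  by exists (Y x) => //=; rewrite mem_index_enum.
elim: (index_enum S) (index_enum_uniq S) => [|a s IH] /=.
  by rewrite !big_nil measure0.
case/andP => /negP as_ us; rewrite !big_cons -(IH us) measureU//.
- exact: mF.
- by apply: bigsetU_measurable => b _; exact: mF.
rewrite -bigcup_seq; apply/seteqP; split => // x [[_ /= Yx] [b /= bs [_ /= Yb]]].
by apply: as_; rewrite -Yx Yb.
Qed.

Lemma measurable_fun_fibers (f : S -> R) :
  (forall a, measurable (Y @^-1` [set a])) -> measurable_fun setT (f \o Y).
Proof.
move=> mY _ U mU; rewrite setTI.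
apply: measurable_fibers => a.
have [Ufa|nUfa] := pselect (U (f a)).
  rewrite (_ : _ `&` _ = Y @^-1` [set a])//.
  by apply/seteqP; split => [x []//|x /= Yx]; split => //=; rewrite Yx.
rewrite (_ : _ `&` _ = set0)//.
by apply/seteqP; split => // x [/= + Yx]; rewrite Yx.
Qed.

End FiniteFibers.

Section Quantization.
Local Open Scope classical_set_scope.
Local Open Scope ring_scope.
Context {R : realType} {d : nat}.

Lemma measurable_coord_ge (t : R) i :
  measurable [set x : borelRV R d | t <= (x : 'rV[R]_d) ord0 i].
Proof.
rewrite -[X in measurable X]setCK; apply: measurableC.
apply: sub_sigma_algebra.
rewrite (_ : ~` _ = (fun x : 'rV[R]_d => x ord0 i) @^-1` [set y | y < t]).
  apply: open_comp; last exact: open_lt.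
  by move=> x _; exact: coord_continuous.
by apply/seteqP; split => x /=; rewrite ltNge => /negP.
Qed.

Lemma measurable_vnorm_ball (B : R) :
  measurable [set x : borelRV R d | vnorm (x : 'rV[R]_d) <= B].
Proof.
have [B0|B0] := leP 0 B; last first.
  rewrite (_ : mkset _ = set0)//; apply/seteqP; split => // x /=.
  by move=> /(le_trans (vnorm_ge0 _)); rewrite leNgt B0.
(* The bound [x_i <= B] is the intersection of all [x_i < B + 1 / (m + 1)], complements of sets
   already known to be measurable. *)
have -> : [set x : borelRV R d | vnorm (x : 'rV[R]_d) <= B] =
    \bigcap_(i in [set: 'I_d]) ([set x : borelRV R d | - B <= (x : 'rV[R]_d) ord0 i] `&`
      \bigcap_(m in [set: nat]) ~` [set x : borelRV R d | B + m.+1%:R^-1 <= (x : 'rV[R]_d) ord0 i]).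
  apply/seteqP; split => x /= xB.
    move=> i _; have := le_trans (coord_le_vnorm (x : 'rV[R]_d) i) xB.
    rewrite ler_norml => /andP[x1 x2]; split => //= m _ /=.
    by apply/negP; rewrite -ltNge (le_lt_trans x2)// ltrDl.
  apply: vnorm_le => // i; have [/= x1 x2] := xB i I; rewrite ler_norml x1 /=.
  apply/ler_addgt0Pr => e e0.
  have /= /negP := x2 (Num.trunc e^-1) I; rewrite -ltNge => /ltW/le_trans; apply.
  rewrite lerD2l invf_ple ?posrE//; apply/ltW.
  have e1 : 0 <= e^-1 by rewrite invr_ge0 ltW.
  by have /andP[] := truncn_itv e1.
apply: fin_bigcap_measurable => [|i _]; first exact: finite_finset.
apply: measurableI; first exact: measurable_coord_ge.
apply: bigcap_measurable => [|m _]; first by exists 0%N.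
by apply: measurableC; exact: measurable_coord_ge.
Qed.

(* Two points of the ball lie in the same cell only if no grid value separates
   any of their coordinates. *)
Lemma quantizer (M delta : R) : 0 <= M -> 0 < delta ->
  exists (S : finType) (cell : borelRV R d -> S) (rep : S -> 'rV[R]_d),
    [/\ forall a, measurable [set x | cell x = a],
        forall a, vnorm (rep a) <= M &
        forall x : 'rV[R]_d, vnorm x <= M -> vnorm (x - rep (cell x)) <= delta].
Proof.
(* The [s] thresholds have spacing [delta] and run from [-M] to within [delta] of [M]. *)
move=> M0 d0; pose s := (Num.trunc ((M + M) / delta)).+1.
pose thr (j : 'I_s) : R := j%:R * delta - M.
pose cell (x : borelRV R d) : {ffun 'I_d * 'I_s -> bool} :=
  [ffun q => thr q.2 <= (x : 'rV[R]_d) ord0 q.1].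
pose good a := fun x : 'rV[R]_d => vnorm x <= M /\ cell x = a.
(* A point of the cell in the ball, or 0 if the cell misses the ball; either way its norm is at most
   [M]. *)
pose rep a := xget 0 (good a).
exists {ffun 'I_d * 'I_s -> bool}, cell, rep; split.
- move=> a; have -> : [set x | cell x = a] = \bigcap_(q in [set: 'I_d * 'I_s])
      [set x : borelRV R d | (thr q.2 <= (x : 'rV[R]_d) ord0 q.1) = a q].
    apply/seteqP; split => x /= xa; first by move=> q _ /=; rewrite -xa ffunE.
    by apply/ffunP => q; rewrite ffunE; exact: xa.
  apply: fin_bigcap_measurable => [|q _]; first exact: finite_finset.
  case: (a q).
    rewrite (_ : mkset _ = [set x : borelRV R d | thr q.2 <= (x : 'rV[R]_d) ord0 q.1]).
      exact: measurable_coord_ge.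
    by apply/seteqP; split.
  rewrite (_ : mkset _ = ~` [set x : borelRV R d | thr q.2 <= (x : 'rV[R]_d) ord0 q.1]).
    by apply: measurableC; exact: measurable_coord_ge.
  by apply/seteqP; split => x /= => [->//|/negP/negbTE].
- move=> a; rewrite /rep; case: xgetP => [x _ []//|_]; rewrite vnorm0//.
have close (x y : 'rV[R]_d) i : vnorm x <= M -> vnorm y <= M -> cell x = cell y ->
    y ord0 i - x ord0 i <= delta.
  move=> xM yM xy; rewrite leNgt; apply/negP => ltd.
  have := le_trans (coord_le_vnorm x i) xM; rewrite ler_norml => /andP[x1 x2].
  have := le_trans (coord_le_vnorm y i) yM; rewrite ler_norml => /andP[y1 y2].
  (* [thr j] is the last threshold not above [y_i]. The equal cells put it at or below [x_i] as
     well, hence [y_i < x_i + delta]. *)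
  pose j := Num.trunc ((y ord0 i + M) / delta).
  have yd0 : 0 <= (y ord0 i + M) / delta by rewrite divr_ge0 ?(ltW d0)//; lra.
  have js : (j < s)%N.
    by rewrite ltnS; apply: le_truncn; rewrite ler_pM2r ?invr_gt0// lerD2r.
  have /andP[j1 j2] := truncn_itv yd0.
  have ty : thr (Ordinal js) <= y ord0 i.
    by rewrite /thr /= lerBlDr -ler_pdivlMr.
  have : thr (Ordinal js) <= x ord0 i.
    by have := congr1 (fun f : {ffun _ -> bool} => f (i, Ordinal js)) xy;
      rewrite !ffunE /= ty => ->.
  move: j2; rewrite -/j ltr_pdivrMr// -natr1 mulrDl mul1r /thr /= => j2.
  by lra.
move=> x xM; rewrite /rep; case: xgetP => [y _ [yM xy]|/(_ x)]; last first.
  by case; split.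
apply: vnorm_le => [|i]; first exact: ltW.
by rewrite !mxE ler_norml lerNl opprB !close.
Qed.

End Quantization.

(** * The probabilistic model *)

Section Model.
Local Open Scope classical_set_scope.
Local Open Scope ring_scope.
Context {R : realType} {d k0 : nat} {p : nat -> R}.
Context {nu : probability (borelRV R d) R} {dO : measure_display}.
Context {Omega : measurableType dO} {P : probability Omega R}.
Context {G : forall n, Omega -> adj n} {X : forall n, Omega -> 'I_n -> borelRV R d}.
Arguments G : clear implicits.
Arguments X : clear implicits.
Hypothesis hp : edge_prob_regime p.
Hypothesis hmodel : featured_ER_model P nu p G X.

Lemma vnorm_dist_dist e (u v : 'rV[R]_e) : `|vnorm u - vnorm v| <= vnorm (u - v).
Proof.
have := vnormD (u - v) v; rewrite subrK => uv.
have := vnormD (v - u) u; rewrite subrK (vnorm_distC v u) => vu.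
by rewrite ler_norml; apply/andP; split; lra.
Qed.

Section Cells.
Context {n : nat} {S : finType} (cell : borelRV R d -> S).
Hypothesis mcell : forall a, measurable [set x | cell x = a].

Definition discretized (w : Omega) : adj n * {ffun 'I_n -> S} :=
  (G n w, [ffun i => cell (X n w i)]).

Lemma discretized_fiber A x : discretized @^-1` [set (A, x)] =
  [set w | G n w = A /\ forall i, [set y | cell y = x i] (X n w i)].
Proof.
apply/seteqP; split => [w [<- <-]|w [GA xE]].
  by split => // i; rewrite ffunE.
by rewrite /= /discretized GA; congr pair; apply/ffunP => i; rewrite ffunE xE.
Qed.

Lemma measurable_rectangle A (B : 'I_n -> set (borelRV R d)) :
  (forall i, measurable (B i)) ->
  measurable [set w | G n w = A /\ forall i, B i (X n w i)].
Proof.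
case: hmodel => mX mG _ mB.
rewrite (_ : mkset _ = [set w | G n w = A] `&`
    \bigcap_(i in [set: 'I_n]) ((fun w => X n w i) @^-1` B i)).
  apply: measurableI; first exact: mG.
  apply: fin_bigcap_measurable => [|i _]; first exact: finite_finset.
  by rewrite -[X in measurable X]setTI; exact: mX.
apply/seteqP; split => [w [GA wB]|w [GA wB]]; split => // i.
  by move=> _; exact: wB.
exact: (wB i I).
Qed.

Variable K : set (borelRV R d).
Hypothesis mK : measurable K.
Hypothesis nuK : nu K = 1%E.

Definition cell_weight (a : S) : R := fine (nu (K `&` cell @^-1` [set a])).

Let mKcell a : measurable (K `&` cell @^-1` [set a]).
Proof. by apply: measurableI => //; exact: mcell. Qed.

Let cell_weightE a : nu (K `&` cell @^-1` [set a]) = (cell_weight a)%:E.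
Proof. by rewrite fineK//; exact: fin_num_measure. Qed.

Lemma cell_weight_ge0 a : 0 <= cell_weight a.
Proof. by rewrite fine_ge0. Qed.

Lemma cell_weight_sum1 : \sum_a cell_weight a = 1.
Proof.
apply: EFin_inj; rewrite -nuK (measure_fibers nu mKcell) -sumEFin.
by apply: eq_bigr => a _; exact/esym/cell_weightE.
Qed.

(** The event is a finite disjoint union of rectangles of the model, one for each graph and word in
    [Q]. Intersecting the cells with [K] keeps the actual features in [K]. *)
Lemma prob_discretized (Q : pred (adj n * {ffun 'I_n -> S})) :
  let D := [set w | Q (discretized w) /\ forall i, K (X n w i)] in
  measurable D /\
  P D = (\sum_(y | Q y) ER_prob (p n) y.1 * pw cell_weight y.2)%:E.
Proof.
move=> D.
pose B (x : {ffun 'I_n -> S}) i := K `&` cell @^-1` [set x i].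
have fiber A x : D `&` discretized @^-1` [set (A, x)] =
    if Q (A, x) then [set w | G n w = A /\ forall i, B x i (X n w i)] else set0.
  rewrite discretized_fiber; case: ifPn => QA.
    apply/seteqP; split => [w|w].
      by move=> [[_ wK] [GA wx]]; split => // i; split; [exact: wK|exact: wx].
    move=> [GA wB]; split; last by split => // i; case: (wB i).
    split; last by move=> i; case: (wB i).
    rewrite (_ : discretized w = (A, x))// /discretized GA; congr pair.
    by apply/ffunP => i; rewrite ffunE; case: (wB i).
  apply/seteqP; split => // w /= [[Qw _] [GA wx]].
  move: QA; rewrite (_ : (A, x) = discretized w) ?Qw// /discretized GA.
  by congr pair; apply/ffunP => i; rewrite ffunE wx.
have mfiber y : measurable (D `&` discretized @^-1` [set y]).
  case: y => A x; rewrite fiber; case: ifP => // _.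
  by apply: measurable_rectangle => i; exact: mKcell.
split; first exact: (measurable_fibers mfiber).
rewrite (measure_fibers P mfiber) -sumEFin [RHS]big_mkcond; apply: eq_bigr => -[A x] _.
rewrite fiber; case: ifP => _; last exact: measure0.
have [_ _ law] := hmodel.
apply: etrans (law n A (B x) _) _ => [i|]; first exact: mKcell.
rewrite EFinM /pw -prodEFin; congr (_ * _)%E.
by apply: eq_bigr => i _; exact: cell_weightE.
Qed.

End Cells.

(** The value is continuous in the features, hence a pointwise limit of functions of ever finer
    [discretized] data, each with finitely many measurable fibres. *)
Lemma measurable_eval_dist n e (t : term R d k0 0 e) z :
  measurable_fun setT
    (fun w => vnorm (eval_closed (G n w) (X n w) t - z)).
Proof.
have qz m : exists q : {S : finType & ((borelRV R d -> S) * (S -> 'rV[R]_d))%type},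
    [/\ forall a, measurable [set x | (projT2 q).1 x = a],
        forall a, vnorm ((projT2 q).2 a) <= m%:R &
        forall x : 'rV[R]_d, vnorm x <= m%:R ->
          vnorm (x - (projT2 q).2 ((projT2 q).1 x)) <= m.+1%:R^-1].
  have m0 : 0 < m.+1%:R^-1 :> R by rewrite invr_gt0.
  have [S [cell [rep H]]] := @quantizer R d m%:R _ (ler0n _ _) m0.
  by exists (existT _ S (cell, rep)).
have [q qP] := choice qz.
pose cell m := (projT2 (q m)).1; pose rep m := (projT2 (q m)).2.
pose val m (y : adj n * {ffun 'I_n -> projT1 (q m)}) : R :=
  vnorm (eval_closed y.1 (rep m \o y.2) t - z).
apply: (@measurable_realfun.measurable_fun_cvg _ _ _ _
  (fun m => val m \o discretized (cell m))) => [m|w _].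
  apply: measurable_fun_fibers => -[A x]; rewrite discretized_fiber.
  by apply: (measurable_rectangle A (B := fun i => [set y | cell m y = x i])) => i;
    case: (qP m) => mcell _ _; exact: mcell.
(* The added 1 leaves room for the representatives, which lie within [1 / (m + 1) <= 1] of the
   features. *)
pose B := \big[Num.max/0]_i vnorm (X n w i : 'rV[R]_d) + 1.
have XB i : vnorm (X n w i : 'rV[R]_d) <= B - 1.
  by rewrite addrK; exact: (le_bigmax 0 (fun i => vnorm (X n w i : 'rV[R]_d))).
have B0 : 0 <= B - 1 by rewrite addrK; exact: bigmax_ge_id.
have [L [L0 LP]] := eval_lipschitz t B.
apply/cvgrPdist_le => eps eps0; near=> m.
have Bm : B <= m%:R by near: m; exact: nbhs_infty_ger.
have Lm : L / eps <= m%:R by near: m; exact: nbhs_infty_ger.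
have m1 : m.+1%:R^-1 <= 1 :> R by rewrite invf_le1 ?ler1n ?ltr0n.
apply: le_trans (vnorm_dist_dist _ _) _; rewrite opprB addrA subrK /eval_closed /=.
have close i : vnorm ((X n w i : 'rV[R]_d) - rep m (cell m (X n w i))) <= m.+1%:R^-1.
  by case: (qP m) => _ _; apply; apply: le_trans (XB i) _; lra.
have -> : rep m \o [ffun i => cell m (X n w i)] = (fun i => rep m (cell m (X n w i))).
  by apply/funext => i /=; rewrite ffunE.
apply: le_trans (LP _ _ _ _ _ m.+1%:R^-1 _ _ _ _) _ => // [i|i|].
- by apply: le_trans (XB i) _; lra.
- rewrite -[rep _ _](subKr (X n w i : 'rV[R]_d)).
  apply: le_trans (vnormD _ _) _; rewrite vnormN.
  by apply: le_trans (lerD (XB i) (le_trans (close i) m1)) _; rewrite subrK.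
rewrite ler_pdivrMr ?ltr0n// mulrC -ler_pdivrMr//.
by apply: le_trans Lm _; rewrite ler_nat.
Unshelve. all: by end_near. Qed.

Lemma measurable_eval_ball n e (t : term R d k0 0 e) z eps :
  measurable [set w | vnorm (eval_closed (G n w) (X n w) t - z) < eps].
Proof.
rewrite (_ : mkset _ = setT `&`
    (fun w => vnorm (eval_closed (G n w) (X n w) t - z)) @^-1` `]-oo, eps[%classic).
  by apply: (measurable_eval_dist n t z) => //; exact: measurable_itv.
by apply/seteqP; split => [w|w []] /=; rewrite in_itv.
Qed.

(** First [a] makes [C / a] small; then [n] grows with [a] fixed, so the factor [2 ^+ a] in the
    low-degree bound is harmless. *)
Lemma ER_sparsity_small (C tau : R) : 0 <= C -> 0 < tau ->
  exists a N, (0 < a)%N /\ forall n, (N <= n)%N -> (0 < n)%N /\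
    C * \sum_(A : adj n) ER_prob (p n) A * sparsity A a <= tau.
Proof.
move=> C0 tau0.
have t3 : 0 < tau / 3 by rewrite divr_gt0.
pose a := (Num.trunc (C / (tau / 3))).+1.
have aP : C / a%:R <= tau / 3.
  rewrite ler_pdivrMr ?ltr0n// mulrC -ler_pdivrMr//; apply/ltW.
  by have /andP[] := truncn_itv (divr_ge0 C0 (ltW t3)).
(* With [y = C 2^a / (tau / 3)], the bounds [n p >= 1 + 2 y] and [p <= 1] give [(n - 1) p >= 2 y],
   as the low-degree term requires. *)
have [N NP] := edge_prob_growth hp (1 + C * 2 ^+ a * 2 / (tau / 3)).
exists a, (maxn a N); split => // n; rewrite geq_max => /andP[an Nn].
have n0 : (0 < n)%N by apply: leq_trans an.
split => //; have p01 := hp.1 n; have /andP[p0 p1] := p01.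
have Cn : C / n%:R <= tau / 3.
  by apply: le_trans aP; rewrite ler_wpM2l// lef_pV2 ?posrE ?ltr0n// ler_nat.
have low : C * (2 ^+ a * (1 + n.-1%:R * (p n / 2))^-1) <= tau / 3.
  have pos : 0 < 1 + n.-1%:R * (p n / 2).
    by rewrite ltr_wpDr// mulr_ge0// divr_ge0.
  rewrite (mulrA C) ler_pdivrMr// [leRHS]mulrC -ler_pdivrMr//.
  have nE : n%:R = n.-1%:R + 1 :> R by rewrite natr1 prednK.
  have := NP n Nn; rewrite nE mulrDl mul1r.
  have -> : C * 2 ^+ a * 2 / (tau / 3) = 2 * (C * 2 ^+ a / (tau / 3)) by ring.
  rewrite [n.-1%:R * (_ / 2)]mulrA.
  move: (C * 2 ^+ a / (tau / 3)) (n.-1%:R * p n) => y u; lra.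
have -> : \sum_(A : adj n) ER_prob (p n) A * sparsity A a =
    \sum_(A : adj n) ER_prob (p n) A * lowdeg A a + (a%:R^-1 + n%:R^-1).
  have -> : a%:R^-1 + n%:R^-1 =
      \sum_(A : adj n) ER_prob (p n) A * (a%:R^-1 + n%:R^-1) :> R.
    by rewrite -mulr_suml sum_ER_prob1 mul1r.
  rewrite -big_split /=; apply: eq_bigr => A _.
  by rewrite -mulrDr addrA.
rewrite !mulrDr; apply: (@le_trans _ _ (tau / 3 + (tau / 3 + tau / 3))); last by lra.
rewrite lerD ?lerD//; apply: le_trans low; rewrite ler_wpM2l//.
exact: ER_lowdeg_le.
Qed.

(** The accuracy [eps] fixes an alphabet, whose limit is [z]; hence [z] precedes [theta]. Half of
    [eps] goes to quantization and half to Markov's inequality for the distance from [z]. *)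
Lemma eval_concentrates (hnu : bounded_distribution nu) e (t : term R d k0 0 e)
    (eps : R) : 0 < eps ->
  exists z, forall theta : R, 0 < theta -> exists N, forall n, (N <= n)%N ->
    ((1 - theta)%:E <=
       P [set w | (vnorm (eval_closed (G n w) (X n w) t - z) < eps)%R])%E.
Proof.
move=> eps0; have [M nuM] := hnu.
have M0 : 0 <= M.
  rewrite leNgt; apply/negP => M0.
  move: nuM; rewrite (_ : mkset _ = set0) ?measure0 => [/eqP|].
    by rewrite eqe eq_sym oner_eq0.
  apply/seteqP; split => // x /= /(le_trans (vnorm_ge0 _)).
  by rewrite leNgt M0.
have mK := @measurable_vnorm_ball R d M.
have [L [L0 LP]] := eval_lipschitz t M.
pose delta := eps / 2 / (L + 1).
have L1 : 0 < L + 1 by rewrite ltr_wpDl.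
have d0 : 0 < delta by rewrite !divr_gt0.
have Ld : L * delta < eps / 2.
  by rewrite /delta mulrA ltr_pdivrMr// mulrC ltr_pM2l ?divr_gt0// ltrDl.
have [S [cell [rep [mcell repM repd]]]] := @quantizer R d M delta M0 d0.
pose wt := cell_weight cell [set x : borelRV R d | vnorm (x : 'rV[R]_d) <= M].
have w0 : forall b, 0 <= wt b by exact: cell_weight_ge0.
have w1 : \sum_b wt b = 1 by exact: cell_weight_sum1.
have [phi [_ phiP]] := eval_approximable w0 w1 repM t.
pose z := phi (fun i : 'I_0 => match notF (ltn_ord i) with end).
have phiE n (x : {ffun 'I_n -> S}) : phi (x \o no_nodes n) = z.
  by congr phi; apply/funext => -[].
exists z => theta theta0.
(* Markov's inequality at threshold [eps / 2] allows a mean error of [theta * (eps / 2)]; one half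
   goes to the approximation, the other to [sparsity]. *)
have tau0 : 0 < theta * (eps / 2) / 2 by rewrite !divr_gt0 ?mulr_gt0 ?divr_gt0.
have [C [C0 CP]] := phiP _ tau0.
have [a [N [a0 NP]]] := ER_sparsity_small C0 tau0.
exists N => n /NP[n0 small].
pose err (y : adj n * {ffun 'I_n -> S}) : R :=
  vnorm (eval_closed y.1 (rep \o y.2) t - z).
have err0 y : 0 <= err y by exact: vnorm_ge0.
pose mass (y : adj n * {ffun 'I_n -> S}) : R := ER_prob (p n) y.1 * pw wt y.2.
have mass0 y : 0 <= mass y.
  by rewrite mulr_ge0 ?ER_prob_ge0 ?pw_ge0//; exact: hp.1.
have mass1 : \sum_y mass y = 1.
  rewrite -(pair_bigA _ (fun A x => ER_prob (p n) A * pw wt x)) /=.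
  rewrite -(sum_ER_prob1 (n := n) (p n)); apply: eq_bigr => A _.
  by rewrite -mulr_sumr pw_sum1// mulr1.
have mean_err : \sum_y mass y * err y <= theta * (eps / 2).
  rewrite -(pair_bigA _ (fun A x => mass (A, x) * err (A, x))) /=.
  apply: (@le_trans _ _ (\sum_(A : adj n) ER_prob (p n) A *
      (theta * (eps / 2) / 2 + C * sparsity A a))).
    apply: ler_sum => A _; rewrite /mass /=.
    under eq_bigr do rewrite -mulrA.
    rewrite -mulr_sumr; have [sA|sA] := boolP (simple_graph A); last first.
      by rewrite /ER_prob (negPf sA) !mul0r.
    rewrite ler_wpM2l ?ER_prob_ge0 ?hp.1//.
    apply: le_trans (CP n A a PNil sA n0 a0); rewrite le_eqVlt; apply/orP; left.
    by apply/eqP/eq_bigr => x _; rewrite /err /= phiE.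
  rewrite (eq_bigr (fun A : adj n => ER_prob (p n) A * (theta * (eps / 2) / 2) +
    C * (ER_prob (p n) A * sparsity A a))) => [|A _]; last first.
    by rewrite mulrDr; congr (_ + _); rewrite mulrCA.
  rewrite big_split /= -mulr_suml -mulr_sumr sum_ER_prob1 mul1r.
  by apply: le_trans (lerD (lexx _) small) _; lra.
pose Q y := err y < eps / 2.
have [mD PD] := @prob_discretized n S cell mcell _ mK Q.
set D := mkset _ in mD PD.
apply: (@le_trans _ _ (P D)).
  rewrite PD lee_fin.
  have -> : \sum_(y | Q y) ER_prob (p n) y.1 *
      pw (cell_weight cell [set x : borelRV R d | vnorm (x : 'rV[R]_d) <= M]) y.2 =
      1 - \sum_(y | ~~ Q y) mass y.
    by rewrite -mass1 [in RHS](bigID Q) /= addrK.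
  (* Markov's inequality: outside [Q] the error is at least [eps / 2]. *)
  rewrite lerD2l lerN2 -(ler_pM2r (_ : 0 < eps / 2)) ?divr_gt0//.
  apply: le_trans mean_err; rewrite mulr_suml [leRHS](bigID Q) /=.
  apply: ler_wpDl; first by apply: sumr_ge0 => y _; rewrite mulr_ge0.
  by apply: ler_sum => y; rewrite /Q -leNgt => ?; rewrite ler_wpM2l.
apply: le_measure; rewrite ?inE//; first exact: measurable_eval_ball.
move=> w /= [Qw wK].
apply: le_lt_trans (vnorm_dist_triangle
  (eval_closed (G n w) (rep \o [ffun i => cell (X n w i)]) t) _ _) _.
have -> : eps = eps / 2 + eps / 2 by lra.
apply: ler_ltD; last exact: Qw.
apply: le_trans (ltW Ld); apply: LP; first exact: ltW.
- exact: wK.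
- by move=> i; exact: repM.
by move=> i /=; rewrite ffunE repd//; exact: wK.
Qed.

End Model.

(** * The limit over finer alphabets *)

Lemma vnorm_complete (R : realType) e (z : nat -> 'rV[R]_e) :
  (forall m m', vnorm (z m - z m') <= m.+1%:R^-1 + m'.+1%:R^-1) ->
  exists l, forall m, vnorm (z m - l) <= m.+1%:R^-1.
Proof.
(* In each coordinate the intervals of radius [1 / (m + 1)] about [z m] meet pairwise, so the
   supremum of their left ends lies in all of them. *)
move=> zc; pose lower i := range (fun m => z m ord0 i - m.+1%:R^-1).
have ub i m : ubound (lower i) (z m ord0 i + m.+1%:R^-1).
  move=> _ [m' _ <-]; rewrite lerBlDr -addrA -lerBlDl.
  have := le_trans (coord_le_vnorm (z m' - z m) i) (zc m' m).
  by rewrite !mxE => /ler_normlW; rewrite addrC [in leRHS]addrC.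
have ne i : lower i !=set0%classic by exists (z 0%N ord0 i - 1%:R^-1); exists 0%N.
exists (\row_i sup (lower i)) => m; apply: vnorm_le => [|i]; first by rewrite invr_ge0.
rewrite !mxE; have hi : sup (lower i) <= z m ord0 i + m.+1%:R^-1.
  exact: ge_sup.
have lo : z m ord0 i - m.+1%:R^-1 <= sup (lower i).
  apply: ub_le_sup; last by exists m.
  by exists (z m ord0 i + m.+1%:R^-1); exact: ub.
move: hi lo; move: (sup _) (m.+1%:R^-1) (z m ord0 i) => a b c hi lo.
by rewrite ler_norml; apply/andP; split; lra.
Qed.

Theorem mainTheorem1 (R : realType) (d k0 : nat) (p : nat -> R)
  (hp : edge_prob_regime p)
  (nu : probability (borelRV R d) R) (hnu : bounded_distribution nu)
  (dO : measure_display) (Omega : measurableType dO) (P : probability Omega R)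
  (G : forall n, Omega -> adj n) (X : forall n, Omega -> 'I_n -> borelRV R d)
  (hmodel : featured_ER_model P nu p G X) :
  forall (e : nat) (t : term R d k0 0 e),
  exists z : 'rV[R]_e,
  forall eps theta : R, 0 < eps -> 0 < theta ->
  exists N : nat, forall n : nat, (N <= n)%N ->
    ((1 - theta)%:E <= P [set w | (vnorm (eval_closed (G n w) (X n w) t - z) < eps)%R]%classic)%E.
Proof.
move=> e t.
have inv0 m : 0 < m.+1%:R^-1 :> R by rewrite invr_gt0.
have [z zP] := choice (fun m => eval_concentrates hp hmodel hnu t (inv0 m)).
pose E n m := [set w | vnorm (eval_closed (G n w) (X n w) t - z m) < m.+1%:R^-1]%classic.
have mE n m : measurable (E n m) by exact: (measurable_eval_ball hmodel).
have [l lP] : exists l, forall m, vnorm (z m - l) <= m.+1%:R^-1.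
  apply: vnorm_complete => m m'.
  (* Two events of probability at least [2 / 3] meet, and a common point compares [z m] with
     [z m']. *)
  have t3 : 0 < 3^-1 :> R by rewrite invr_gt0.
  have [N1 N1P] := zP m _ t3; have [N2 N2P] := zP m' _ t3.
  pose n := maxn N1 N2.
  have E1 := N1P n (leq_maxl _ _); have E2 := N2P n (leq_maxr _ _).
  have [w [w1 w2]] : (E n m `&` E n m' !=set0)%classic.
    apply/set0P/negP => /eqP E0.
    have := probability_le1 P (measurableU _ _ (mE n m) (mE n m')).
    rewrite measureU// => /(le_trans (leeD E1 E2)); rewrite -EFinD lee_fin.
    by lra.
  apply: le_trans (vnorm_dist_triangle (eval_closed (G n w) (X n w) t) _ _) _.
  by rewrite vnorm_distC; apply: lerD; exact: ltW.
exists l => eps theta eps0 theta0.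
pose m := Num.trunc (eps / 2)^-1.
have me : m.+1%:R^-1 <= eps / 2.
  have e2 : 0 < eps / 2 by rewrite divr_gt0.
  rewrite invf_ple ?posrE//; apply/ltW.
  have e20 : 0 <= (eps / 2)^-1 by rewrite invr_ge0 ltW.
  by have /andP[] := truncn_itv e20.
have [N NP] := zP m theta theta0; exists N => n /NP/le_trans; apply.
apply: le_measure; rewrite ?inE; [exact: mE|exact: (measurable_eval_ball hmodel)|].
move=> w /= wm; apply: le_lt_trans (vnorm_dist_triangle (z m) _ _) _.
have -> : eps = eps / 2 + eps / 2 by lra.
apply: ltr_leD; first exact: lt_le_trans me.
exact: le_trans (lP m) me.
Qed.
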